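(* Let $0\le\rho\le 1/2$ and let $f(z)=z+\sum_{n=2}^\infty a_nz^n$ belong to the class $ST_\sigma(\rho)$ of bi-starlike functions of order $\rho$. Then $$|a_5|\le\frac{2}{3}(1-\rho)+\frac{3}{2}(1-\rho)^2+\frac{2}{3}\sqrt{2}\,(1-\rho)^{3/2}.$$
   Context: $\mathbb{D}=\{z\in\mathbb{C}:|z|<1\}$. $\mathcal{A}$ is the class of analytic functions $f$ on $\mathbb{D}$ with $f(0)=0$, $f'(0)=1$. A function $f\in\mathcal{A}$ is bi-univalent if $f$ is univalent (injective) in $\mathbb{D}$ and its inverse $f^{-1}$ (defined near $0$) has a univalent analytic continuation $g$ to $\mathbb{D}$; $\sigma$ denotes the class of bi-univalent functions. For analytic functions $F,G$ on $\mathbb{D}$, $F\prec G$ means there is an analytic $w$ on $\mathbb{D}$ with $w(0)=0$, $|w(z)|<1$ and $F(z)=G(w(z))$. For $0\le\rho<1$, $ST_\sigma(\rho)$ is the class of $f\in\sigma$ such that $$\frac{zf'(z)}{f(z)}\prec\frac{1+(1-2\rho)z}{1-z}\quad\text{and}\quad\frac{wg'(w)}{g(w)}\prec\frac{1+(1-2\rho)w}{1-w}$$ in $\mathbb{D}$, where $g$ is the analytic continuation of $f^{-1}$ to $\mathbb{D}$. *)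

(* Defs.v *)
From Stdlib Require Import Reals.
From Coquelicot Require Import Coquelicot.

Open Scope R_scope.

(* Functions on the unit disk are total functions [C -> C] whose values outside
   the disk are irrelevant. *)
Definition in_disk (z : C) : Prop := Cmod z < 1.

Definition analytic_on_disk (F : C -> C) : Prop :=
  forall z0 : C, in_disk z0 ->
    exists (c : nat -> C) (r : R), 0 < r /\
      forall z : C, Cmod (z - z0) < r -> is_pseries c (z - z0)%C (F z).

Definition univalent_on_disk (F : C -> C) : Prop :=
  analytic_on_disk F /\
  forall z1 z2 : C, in_disk z1 -> in_disk z2 -> F z1 = F z2 -> z1 = z2.

Definition class_A (f : C -> C) : Prop :=
  analytic_on_disk f /\ f 0%C = 0%C /\ is_derive f (0%C : C) (1%C : C).

(* [g] is a univalent analytic function on the disk which coincides near 0 with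
   the inverse of [f : disk -> f(disk)]: for [w] near 0, [g w] is the point of
   the disk that [f] maps to [w]. *)
Definition univalent_inverse_continuation (f g : C -> C) : Prop :=
  univalent_on_disk g /\
  exists r : R, 0 < r /\
    forall w : C, Cmod w < r -> in_disk (g w) /\ f (g w) = w.

Definition bi_univalent (f : C -> C) : Prop :=
  class_A f /\ univalent_on_disk f /\
  exists g : C -> C, univalent_inverse_continuation f g.

Definition subordinate (F G : C -> C) : Prop :=
  exists w : C -> C,
    analytic_on_disk w /\ w 0%C = 0%C /\
    forall z : C, in_disk z -> in_disk (w z) /\ F z = G (w z).

(* The function z f'(z) / f(z), with its removable singularity at 0 filled in:
   for f(0) = 0 and f'(0) <> 0 the limit at 0 is 1, whereas the total division
   of Coquelicot would return 0 there. *)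
Definition starlike_quotient (f : C -> C) (z : C) : C :=
  if Ceq_dec z 0%C then 1%C else (z * C_derive f z / f z)%C.

Definition half_plane_map (rho : R) (z : C) : C :=
  ((1 + RtoC (1 - 2 * rho) * z) / (1 - z))%C.

(* By the identity theorem the continuation [g] is unique on the disk, so the
   existential quantifier ranges over the one continuation of the inverse. *)
Definition ST_sigma (rho : R) (f : C -> C) : Prop :=
  bi_univalent f /\
  exists g : C -> C,
    univalent_inverse_continuation f g /\
    subordinate (starlike_quotient f) (half_plane_map rho) /\
    subordinate (starlike_quotient g) (half_plane_map rho).

(* Main.v *)
Require Import Defs.
From Stdlib Require Import Reals ZArith Lra Lia.
From Coquelicot Require Import Coquelicot.
Open Scope R_scope.

(** Write [b = 1 - rho] and let [s_k], [t_k] be the Taylor coefficients at 0 of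
    [z f'/f] and [w g'/g].  Both quotients start with 1, map the disk into the
    half-plane [Re > rho], and so, by the Caratheodory bound
    ([caratheodory_coefficient_bound]), satisfy [|s_k| <= 2 b], [|t_k| <= 2 b].
    Inverting the formulas for [s_k] in terms of the [a_k] gives
    [a_5 = s_4/4 + s_1 s_3/3 + s_2^2/8 + s_1^2 s_2/4 + s_1^4/24].  The inverse
    function enters only through [t_2 = 3 a_2^2 - 2 a_3], that is
    [s_2 + t_2 = 2 s_1^2], which improves the bound on [s_1] to
    [|s_1|^2 <= 2 b].  The triangle inequality then yields
    [|a_5| <= b/2 + 5/3 b^2 + 2/3 b sqrt (2 b)], and since [b <= 1] this is at
    most [2/3 b + 3/2 b^2 + 2/3 b sqrt (2 b)], the asserted bound.

    The analytic part is the Caratheodory bound for a function [P] about which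
    only local information is available (a power series around each point of
    the disk, the one around 0 converging a priori only near 0).  The link
    between 0 and the whole disk is a differential equation: for
    [I(r) = int_0^(2 pi) Re (kappa P(r e^(it)) e^(-ijt)) dt], differentiation
    under the integral sign and integration by parts in [t] give
    [r I'(r) = j I(r)] ([is_derive_harmonic]), because the radial and the
    angular derivative of an analytic function are proportional.  Hence
    [I(r) r^(-j)] is constant on [(0,1)], and letting [r] tend to 0 identifies
    the constant with the [j]-th Taylor coefficient at 0, or with 0 when [j] is
    negative ([harmonic_power_law]).  For [P] with nonnegative real part, the
    coefficients for [n] and [-n] add up to an integral of [Re P] against twice
    a cosine, which is at most [2 int Re P].

    The computation needs [P] to be continuously differentiable.  This is encoded
    by differentiability in the strict sense ([strict_diff]), which follows from a
    single local power series and entails continuity of the derivative.  The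
    Taylor coefficients of the starlike quotients are found by cross-multiplying
    [z f' = (z f'/f) f] up to terms of high order at 0. *)

(** * Power series and their Taylor polynomials *)

Fixpoint taylor_poly (c : nat -> C) (N : nat) (z : C) : C :=
  match N with
  | O => c O
  | S n => (taylor_poly c n z + c (S n) * z ^ (S n))%C
  end.

Lemma pow_n_Cpow (z : C) (k : nat) : @pow_n C_AbsRing z k = (z ^ k)%C.
Proof.
  induction k as [|k IH]; [reflexivity|].
  rewrite Cpow_S, <- IH. reflexivity.
Qed.

Lemma sum_n_taylor_poly (c : nat -> C) (z : C) (N : nat) :
  sum_n (fun k => scal (@pow_n C_AbsRing z k) (c k)) N = taylor_poly c N z.
Proof.
  induction N as [|n IH].
  - rewrite sum_O. cbn. unfold scal; cbn. unfold mult; cbn. ring.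
  - rewrite sum_Sn, IH, pow_n_Cpow. cbn [taylor_poly].
    change (taylor_poly c n z + z ^ S n * c (S n) =
            taylor_poly c n z + c (S n) * z ^ S n)%C.
    ring.
Qed.

Lemma is_pseries_approx (c : nat -> C) (z l : C) :
  is_pseries c z l ->
  forall eps, 0 < eps ->
  exists n0, forall n, (n0 <= n)%nat -> Cmod (taylor_poly c n z - l) < eps.
Proof.
  intros H eps Heps.
  unfold is_pseries, is_series in H.
  assert (He : 0 < eps / sqrt 2).
  { apply Rdiv_lt_0_compat; [exact Heps|apply sqrt_lt_R0; lra]. }
  assert (H' := proj1 (filterlim_locally _ _) H (mkposreal _ He)).
  destruct H' as [n0 Hn]. exists n0. intros n Hnn.
  specialize (Hn n Hnn).
  apply C_NormedModule_mixin_compat2 in Hn.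
  rewrite sum_n_taylor_poly in Hn. simpl in Hn.
  replace (sqrt 2 * (eps / sqrt 2)) with eps in Hn.
  - exact Hn.
  - field. apply Rgt_not_eq, sqrt_lt_R0; lra.
Qed.

Lemma taylor_poly_at_0 (c : nat -> C) (N : nat) : taylor_poly c N 0%C = c O.
Proof.
  induction N as [|N IH]; [reflexivity|]. cbn [taylor_poly].
  rewrite IH, Cpow_S. ring.
Qed.

Lemma is_pseries_at_0 (c : nat -> C) (l : C) : is_pseries c (RtoC 0) l -> l = c O.
Proof.
  intros H.
  assert (Hz : Cmod (c O - l) = 0).
  { apply Rle_antisym; [|apply Cmod_ge_0]. apply Rnot_lt_le. intros Hp.
    destruct (is_pseries_approx c (RtoC 0) l H _ Hp) as [n Hn].
    specialize (Hn n (le_n n)). rewrite taylor_poly_at_0 in Hn. lra. }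
  apply Cmod_eq_0 in Hz. replace l with (c O - (c O - l))%C by ring.
  rewrite Hz. ring.
Qed.

Lemma is_pseries_terms_bounded (c : nat -> C) (z l : C) :
  is_pseries c z l -> exists M, 0 < M /\ forall k, Cmod (c k * z ^ k) <= M.
Proof.
  intros H. unfold is_pseries, is_series in H.
  destruct (filterlim_bounded _ (ex_intro _ l H)) as [M HM].
  assert (HM' : forall n, Cmod (taylor_poly c n z) <= M).
  { intros n. rewrite <- sum_n_taylor_poly. apply HM. }
  assert (M0 : 0 <= M) by (eapply Rle_trans; [apply Cmod_ge_0|apply (HM' O)]).
  exists (2 * M + 1). split; [lra|]. intros [|k].
  - specialize (HM' O). cbn [taylor_poly] in HM'.
    replace (c O * z ^ 0)%C with (c O) by (simpl; ring). lra.
  - assert (H1 := HM' k). assert (H2 := HM' (S k)).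
    replace (c (S k) * z ^ S k)%C
      with (taylor_poly c (S k) z + - taylor_poly c k z)%C
      by (cbn [taylor_poly]; ring).
    eapply Rle_trans; [apply Cmod_triangle|]. rewrite Cmod_opp. lra.
Qed.

Lemma Cpow_lipschitz (y z : C) (m : R) (k : nat) :
  Cmod y <= m -> Cmod z <= m ->
  Cmod (z ^ S k - y ^ S k) <= INR (S k) * m ^ k * Cmod (z - y).
Proof.
  intros Hy Hz.
  assert (Hm : 0 <= m) by (eapply Rle_trans; [apply Cmod_ge_0|exact Hy]).
  induction k as [|k IH].
  - simpl. rewrite !Cmult_1_r. lra.
  - replace (z ^ S (S k) - y ^ S (S k))%C
      with (z * (z ^ S k - y ^ S k) + (z - y) * y ^ S k)%C
      by (rewrite !(Cpow_S _ (S k)); ring).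
    eapply Rle_trans; [apply Cmod_triangle|].
    rewrite !Cmod_mult, Cmod_pow, (S_INR (S k)).
    assert (H1 : Cmod z * Cmod (z ^ S k - y ^ S k)
                 <= m * (INR (S k) * m ^ k * Cmod (z - y))).
    { apply Rmult_le_compat; auto using Cmod_ge_0. }
    assert (H2 : Cmod (z - y) * Cmod y ^ S k <= Cmod (z - y) * m ^ S k).
    { apply Rmult_le_compat_l; [apply Cmod_ge_0|].
      apply pow_incr; split; auto using Cmod_ge_0. }
    simpl pow in *. lra.
Qed.

(** Increments of the Taylor remainder are summed term by term, so that one estimate
    serves three purposes: [N = 1] is strict differentiability at the centre,
    [y = 0] bounds the remainder itself, and [y] close to [z] bounds its
    derivative.  On a disk four times smaller than that of convergence,
    [|c_k (z^k - y^k)|] is at most [k (m/s)^(k-1) M/s |z - y|] with [m/s <= 1/2],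
    an arithmetico-geometric series. *)
Lemma taylor_remainder_lipschitz (c : nat -> C) (r : R) (G : C -> C) (N : nat) :
  0 < r -> (forall u, Cmod u < r -> is_pseries c u (G u)) ->
  exists K delta, 0 < K /\ 0 < delta <= r / 4 /\
  forall m y z, m <= delta -> Cmod y <= m -> Cmod z <= m ->
    Cmod (G z - G y - (taylor_poly c N z - taylor_poly c N y))
      <= K * m ^ N * Cmod (z - y).
Proof.
  intros Hr HG.
  pose (s := r / 2).
  assert (Hs : 0 < s) by (unfold s; lra).
  assert (HsC : Cmod (RtoC s) = s) by (rewrite Cmod_R; apply Rabs_pos_eq; lra).
  destruct (is_pseries_terms_bounded c (RtoC s) (G (RtoC s))) as [M [HM Hb]].
  { apply HG. rewrite HsC. unfold s. lra. }
  assert (Hc : forall k, Cmod (c k) <= M / s ^ k).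
  { intros k. specialize (Hb k). rewrite Cmod_mult, Cmod_pow, HsC in Hb.
    apply Rle_div_r; [apply pow_lt; exact Hs|exact Hb]. }
  (* [A] is the sum over [j >= 0] of [(N + 1 + j) / 2^j]; [B d] below uses its
     partial sums. *)
  pose (A := 2 * INR N + 4).
  assert (HA : 4 <= A) by (unfold A; assert (h := pos_INR N); lra).
  exists (M / s * / s ^ N * A), (s / 2). split; [|split].
  { apply Rmult_lt_0_compat; [|lra].
    apply Rmult_lt_0_compat; [apply Rdiv_lt_0_compat; lra|].
    apply Rinv_0_lt_compat, pow_lt, Hs. }
  { unfold s; lra. }
  intros m y z Hm Hy Hz.
  assert (Hm0 : 0 <= m) by (eapply Rle_trans; [apply Cmod_ge_0|exact Hy]).
  pose (x := m / s).
  assert (Hx0 : 0 <= x) by (apply Rdiv_le_0_compat; lra).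
  assert (Hx : x <= 1 / 2) by (unfold x; apply Rle_div_l; lra).
  pose (B d := M / s * x ^ N * (A - (INR N + INR d + 2) * 2 * (1 / 2) ^ d)
               * Cmod (z - y)).
  assert (HB : forall d,
    Cmod (taylor_poly c (N + d) z - taylor_poly c (N + d) y
          - (taylor_poly c N z - taylor_poly c N y)) <= B d).
  { induction d as [|d IH].
    - rewrite Nat.add_0_r. unfold B, A. simpl.
      replace (_ - _)%C with (RtoC 0) by ring. rewrite Cmod_0.
      apply Req_le. ring.
    - rewrite Nat.add_succ_r. cbn [taylor_poly].
      replace (_ - _)%C with
        ((taylor_poly c (N + d) z - taylor_poly c (N + d) y
          - (taylor_poly c N z - taylor_poly c N y))
         + c (S (N + d)) * (z ^ S (N + d) - y ^ S (N + d)))%C by ring.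
      eapply Rle_trans; [apply Cmod_triangle|].
      rewrite Cmod_mult.
      assert (H1 : Cmod (c (S (N + d))) * Cmod (z ^ S (N + d) - y ^ S (N + d))
        <= M / s ^ S (N + d) * (INR (S (N + d)) * m ^ (N + d) * Cmod (z - y))).
      { apply Rmult_le_compat; auto using Cmod_ge_0.
        apply Cpow_lipschitz; assumption. }
      assert (H2 : M / s ^ S (N + d) * (INR (S (N + d)) * m ^ (N + d) * Cmod (z - y))
        = M / s * INR (S (N + d)) * (x ^ N * x ^ d) * Cmod (z - y)).
      { rewrite <- pow_add. unfold x, Rdiv. rewrite Rpow_mult_distr, pow_inv.
        simpl pow. field. split; [apply pow_nonzero|]; lra. }
      assert (H3 : M / s * INR (S (N + d)) * (x ^ N * x ^ d) * Cmod (z - y)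
        <= M / s * INR (S (N + d)) * (x ^ N * (1 / 2) ^ d) * Cmod (z - y)).
      { apply Rmult_le_compat_r; [apply Cmod_ge_0|].
        apply Rmult_le_compat_l.
        - apply Rmult_le_pos; [|apply pos_INR]. apply Rdiv_le_0_compat; lra.
        - apply Rmult_le_compat_l; [apply pow_le, Hx0|].
          apply pow_incr; split; assumption. }
      assert (H4 : B (S d) = B d
        + M / s * INR (S (N + d)) * (x ^ N * (1 / 2) ^ d) * Cmod (z - y)).
      { unfold B. rewrite !S_INR, plus_INR. simpl pow. field. lra. }
      lra. }
  assert (HB' : forall d, B d <= M / s * / s ^ N * A * m ^ N * Cmod (z - y)).
  { intros d. unfold B. apply Rmult_le_compat_r; [apply Cmod_ge_0|].
    replace (M / s * / s ^ N * A * m ^ N) with (M / s * x ^ N * A).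
    2:{ unfold x, Rdiv. rewrite Rpow_mult_distr, pow_inv. ring. }
    apply Rmult_le_compat_l.
    - apply Rmult_le_pos; [apply Rdiv_le_0_compat; lra|apply pow_le, Hx0].
    - assert (0 <= (INR N + INR d + 2) * 2 * (1 / 2) ^ d); [|lra].
      apply Rmult_le_pos; [|apply pow_le; lra].
      assert (h := pos_INR N). assert (h' := pos_INR d). lra. }
  (* Both partial sums converge, so the bound on their increments passes to the limit. *)
  apply Rnot_lt_le. intros Habs.
  set (D := Cmod (G z - G y - (taylor_poly c N z - taylor_poly c N y))) in *.
  set (E := M / s * / s ^ N * A * m ^ N * Cmod (z - y)) in *.
  assert (He : 0 < (D - E) / 3) by lra.
  assert (Hz' : is_pseries c z (G z)) by (apply HG; unfold s in *; lra).
  assert (Hy' : is_pseries c y (G y)) by (apply HG; unfold s in *; lra).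
  destruct (is_pseries_approx _ _ _ Hz' _ He) as [n1 Hn1].
  destruct (is_pseries_approx _ _ _ Hy' _ He) as [n2 Hn2].
  specialize (Hn1 (N + (n1 + n2))%nat ltac:(lia)).
  specialize (Hn2 (N + (n1 + n2))%nat ltac:(lia)).
  specialize (HB (n1 + n2)%nat). specialize (HB' (n1 + n2)%nat).
  assert (D <= Cmod (taylor_poly c (N + (n1 + n2)) z
                     - taylor_poly c (N + (n1 + n2)) y
                     - (taylor_poly c N z - taylor_poly c N y))
               + Cmod (taylor_poly c (N + (n1 + n2)) z - G z)
               + Cmod (taylor_poly c (N + (n1 + n2)) y - G y)); [|lra].
  unfold D.
  set (t1 := taylor_poly c (N + (n1 + n2)) z).
  set (t2 := taylor_poly c (N + (n1 + n2)) y).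
  set (t3 := taylor_poly c N z). set (t4 := taylor_poly c N y).
  replace (G z - G y - (t3 - t4))%C
    with ((t1 - t2 - (t3 - t4)) + - (t1 - G z) + (t2 - G y))%C by ring.
  eapply Rle_trans; [apply Cmod_triangle|].
  apply Rplus_le_compat_r.
  eapply Rle_trans; [apply Cmod_triangle|]. rewrite Cmod_opp. lra.
Qed.

(** * Strict differentiability *)

(** A quantitative form of being continuously differentiable at [z0].  The two
    points vary independently, so that comparing with the derivative at [z]
    gives a Lipschitz bound for the derivative at [z0]. *)
Definition strict_diff (P : C -> C) (z0 l : C) : Prop :=
  exists K delta, 0 < K /\ 0 < delta /\
  forall y z, Cmod (y - z0) < delta -> Cmod (z - z0) < delta ->
    Cmod (P z - P y - l * (z - y))
      <= K * (Cmod (y - z0) + Cmod (z - z0)) * Cmod (z - y).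

Lemma analytic_strict_diff (F : C -> C) (z0 : C) :
  analytic_on_disk F -> in_disk z0 -> exists l, strict_diff F z0 l.
Proof.
  intros HF Hz0. destruct (HF z0 Hz0) as [c [r [Hr Hc]]].
  destruct (taylor_remainder_lipschitz c r (fun u => F (z0 + u)%C) 1 Hr)
    as [K [d [HK [Hd H]]]].
  { intros u Hu. specialize (Hc (z0 + u)%C).
    replace (z0 + u - z0)%C with u in Hc by ring. apply Hc, Hu. }
  exists (c 1%nat), K, d. split; [exact HK|split; [lra|]].
  intros y z Hy Hz.
  specialize (H (Rmax (Cmod (y - z0)) (Cmod (z - z0))) (y - z0)%C (z - z0)%C).
  cbn [taylor_poly] in H.
  replace (z0 + (z - z0))%C with z in H by ring.
  replace (z0 + (y - z0))%C with y in H by ring.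
  replace (z - z0 - (y - z0))%C with (z - y)%C in H by ring.
  replace (F z - F y - c 1%nat * (z - y))%C with
    (F z - F y - (c 0%nat + c 1%nat * (z - z0) ^ 1
                  - (c 0%nat + c 1%nat * (y - z0) ^ 1)))%C
    by (simpl; ring).
  eapply Rle_trans; [apply H|].
  - apply Rmax_lub; lra.
  - apply Rmax_l.
  - apply Rmax_r.
  - apply Rmult_le_compat_r; [apply Cmod_ge_0|].
    apply Rmult_le_compat_l; [lra|].
    assert (h1 := Cmod_ge_0 (y - z0)). assert (h2 := Cmod_ge_0 (z - z0)).
    rewrite pow_1. apply Rmax_lub; lra.
Qed.

Lemma strict_diff_quadratic (P : C -> C) (z l : C) :
  strict_diff P z l ->
  exists K delta, 0 < K /\ 0 < delta /\ forall h, Cmod h < delta ->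
    Cmod (P (z + h)%C - P z - l * h) <= K * Cmod h ^ 2.
Proof.
  intros [K [d [HK [Hd H]]]]. exists K, d. split; [exact HK|split; [exact Hd|]].
  intros h Hh. specialize (H z (z + h)%C).
  replace (z - z)%C with (RtoC 0) in H by ring.
  replace (z + h - z)%C with h in H by ring.
  rewrite Cmod_0 in H. specialize (H Hd Hh). lra.
Qed.

Lemma strict_diff_lipschitz (P : C -> C) (z0 l : C) :
  strict_diff P z0 l ->
  exists L delta, 0 < L /\ 0 < delta /\ forall z, Cmod (z - z0) < delta ->
    Cmod (P z - P z0) <= L * Cmod (z - z0).
Proof.
  intros H. destruct (strict_diff_quadratic P z0 l H) as [K [d [HK [Hd Hq]]]].
  exists (Cmod l + K * d), d.
  assert (h := Cmod_ge_0 l). assert (0 < K * d) by (apply Rmult_lt_0_compat; lra).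
  split; [lra|split; [exact Hd|]]. intros z Hz.
  specialize (Hq _ Hz). replace (z0 + (z - z0))%C with z in Hq by ring.
  replace (P z - P z0)%C with (P z - P z0 - l * (z - z0) + l * (z - z0))%C by ring.
  eapply Rle_trans; [apply Cmod_triangle|]. rewrite Cmod_mult.
  assert (h1 := Cmod_ge_0 (z - z0)).
  assert (K * Cmod (z - z0) ^ 2 <= K * d * Cmod (z - z0)); [|lra].
  rewrite Rmult_assoc. apply Rmult_le_compat_l; [lra|].
  simpl. rewrite Rmult_1_r. apply Rmult_le_compat_r; lra.
Qed.

Lemma strict_diff_is_derive (P : C -> C) (z l : C) :
  strict_diff P z l -> is_derive P z l.
Proof.
  intros H. destruct (strict_diff_quadratic P z l H) as [K [d [HK [Hd Hq]]]].
  split; [apply is_linear_scal_l|].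
  intros x Hx.
  assert (Ex : x = z).
  { apply eq_sym, is_filter_lim_locally_unique, Hx. }
  subst x. intros eps.
  assert (Hd' : 0 < Rmin d (eps / K)).
  { apply Rmin_pos; [exact Hd|apply Rdiv_lt_0_compat; [apply cond_pos|exact HK]]. }
  exists (mkposreal _ Hd'). intros y Hy.
  change (Cmod (y - z) < Rmin d (eps / K)) in Hy.
  change (Cmod (P y - P z - (y - z) * l) <= eps * Cmod (y - z)).
  assert (Hy1 := Rlt_le_trans _ _ _ Hy (Rmin_l _ _)).
  assert (Hy2 := Rlt_le_trans _ _ _ Hy (Rmin_r _ _)).
  specialize (Hq _ Hy1).
  assert (E : forall a b : C, (a + (b - a))%C = b) by (intros; ring).
  rewrite E in Hq. rewrite (Cmult_comm (y - z) l).
  eapply Rle_trans; [exact Hq|].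
  simpl. rewrite Rmult_1_r, <- Rmult_assoc.
  apply Rmult_le_compat_r; [apply Cmod_ge_0|].
  apply Rlt_le. rewrite Rmult_comm. apply Rlt_div_r in Hy2; lra.
Qed.

Lemma strict_diff_C_derive (P : C -> C) (z l : C) :
  strict_diff P z l -> C_derive P z = l.
Proof. intros H. apply is_C_derive_unique, strict_diff_is_derive, H. Qed.

(** Identifies or bounds a derivative: dividing by [|h|] and letting [h] tend to 0
    removes the quadratic error. *)
Lemma Cmod_slope_le (a : C) (M K delta : R) :
  0 < delta ->
  (forall h, Cmod h < delta -> Cmod (a * h) <= (M + K * Cmod h) * Cmod h) ->
  Cmod a <= M.
Proof.
  intros Hd H. apply Rnot_lt_le. intros Hlt.
  pose (e := Cmod a - M).
  pose (t := Rmin (delta / 2) (e / (2 * (Rabs K + 1)))).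
  assert (HK := Rabs_pos K).
  assert (Ht : 0 < t).
  { apply Rmin_pos; [lra|]. apply Rdiv_lt_0_compat; unfold e; lra. }
  assert (HtC : Cmod (RtoC t) = t) by (rewrite Cmod_R; apply Rabs_pos_eq; lra).
  assert (Ht1 : t <= delta / 2) by apply Rmin_l.
  assert (Ht2 : t <= e / (2 * (Rabs K + 1))) by apply Rmin_r.
  specialize (H (RtoC t)). rewrite Cmod_mult, HtC in H.
  specialize (H ltac:(lra)). apply Rmult_le_reg_r in H; [|exact Ht].
  apply Rle_div_r in Ht2; [|lra].
  assert (K * t <= Rabs K * t)
    by (apply Rmult_le_compat_r; [lra|apply Rle_abs]).
  assert (0 < e) by (unfold e; lra).
  unfold e in *. nra.
Qed.

(** Expanding [P (z + h) - P z] with the derivative at [z0] (strict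
    differentiability there) and with the derivative at [z] (differentiability
    there) and comparing bounds [(D z - D z0) h]. *)
Lemma strict_diff_derivative_continuous (P D : C -> C) (z0 : C) :
  in_disk z0 -> (forall z, in_disk z -> strict_diff P z (D z)) ->
  exists L delta, 0 < L /\ 0 < delta /\ forall z, Cmod (z - z0) < delta ->
    in_disk z /\ Cmod (D z - D z0) <= L * Cmod (z - z0).
Proof.
  intros Hz0 HP. destruct (HP z0 Hz0) as [K [d [HK [Hd H]]]].
  unfold in_disk in Hz0.
  exists (2 * K), (Rmin d (1 - Cmod z0)).
  split; [lra|split; [apply Rmin_pos; lra|]]. intros z Hz.
  assert (Hz1 := Rlt_le_trans _ _ _ Hz (Rmin_l _ _)).
  assert (Hz2 := Rlt_le_trans _ _ _ Hz (Rmin_r _ _)).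
  assert (Hzd : in_disk z).
  { unfold in_disk. replace z with (z0 + (z - z0))%C by ring.
    eapply Rle_lt_trans; [apply Cmod_triangle|]. lra. }
  split; [exact Hzd|].
  destruct (strict_diff_quadratic _ _ _ (HP z Hzd)) as [K' [d' [HK' [Hd' H']]]].
  apply (Cmod_slope_le _ _ (K + K') (Rmin d' (d - Cmod (z - z0)))).
  { apply Rmin_pos; lra. }
  intros h Hh.
  assert (Hh1 := Rlt_le_trans _ _ _ Hh (Rmin_l _ _)).
  assert (Hh2 := Rlt_le_trans _ _ _ Hh (Rmin_r _ _)).
  specialize (H' h Hh1).
  assert (Hzh : Cmod (z + h - z0) <= Cmod (z - z0) + Cmod h).
  { replace (z + h - z0)%C with (z - z0 + h)%C by ring. apply Cmod_triangle. }
  specialize (H z (z + h)%C Hz1 ltac:(lra)).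
  replace (z + h - z)%C with h in H by ring.
  replace ((D z - D z0) * h)%C
    with (P (z + h) - P z - D z0 * h + - (P (z + h) - P z - D z * h))%C by ring.
  eapply Rle_trans; [apply Cmod_triangle|]. rewrite Cmod_opp.
  assert (Hp := Cmod_ge_0 h).
  assert (K * (Cmod (z - z0) + Cmod (z + h - z0)) * Cmod h
          <= K * (Cmod (z - z0) + (Cmod (z - z0) + Cmod h)) * Cmod h); [|simpl in H'; lra].
  apply Rmult_le_compat_r; [exact Hp|]. apply Rmult_le_compat_l; lra.
Qed.

Lemma strict_diff_affine (P : C -> C) (a b z0 l : C) :
  strict_diff P z0 l -> strict_diff (fun z => a + b * P z)%C z0 (b * l).
Proof.
  intros [K [d [HK [Hd H]]]].
  assert (hb := Cmod_ge_0 b).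
  exists ((Cmod b + 1) * K), d.
  split; [apply Rmult_lt_0_compat; lra|split; [exact Hd|]].
  intros y z Hy Hz. specialize (H y z Hy Hz).
  replace (_ - _)%C with (b * (P z - P y - l * (z - y)))%C by ring.
  rewrite Cmod_mult, !Rmult_assoc.
  apply Rmult_le_compat; try apply Cmod_ge_0; lra.
Qed.

Lemma strict_diff_inv (u : C -> C) (z0 l : C) :
  strict_diff u z0 l -> u z0 <> 0%C ->
  strict_diff (fun z => / u z)%C z0 (- l / (u z0 * u z0)).
Proof.
  intros Hu Hu0.
  destruct (strict_diff_lipschitz u z0 l Hu) as [L [d1 [HL [Hd1 HLip]]]].
  destruct Hu as [K [d [HK [Hd H]]]].
  pose (e := Cmod (u z0) / 2).
  assert (He : 0 < e) by (apply Cmod_gt_0 in Hu0; unfold e; lra).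
  pose (d' := Rmin d (Rmin d1 (e / L))).
  assert (HeL : 0 < e / L) by (apply Rdiv_lt_0_compat; lra).
  assert (Hd' : 0 < d') by (repeat apply Rmin_pos; lra).
  assert (Hd'1 : d' <= d) by apply Rmin_l.
  assert (Hd'2 : d' <= d1) by (eapply Rle_trans; [apply Rmin_r|apply Rmin_l]).
  assert (Hd'3 : d' <= e / L) by (eapply Rle_trans; [apply Rmin_r|apply Rmin_r]).
  assert (Hlow : forall z, Cmod (z - z0) < d' -> e <= Cmod (u z)).
  { intros z Hz. specialize (HLip z ltac:(lra)).
    assert (L * Cmod (z - z0) <= e).
    { rewrite Rmult_comm. apply Rle_div_r; lra. }
    assert (Cmod (u z0) <= Cmod (u z) + Cmod (u z - u z0)); [|unfold e in *; lra].
    replace (u z0) with (u z + - (u z - u z0))%C at 1 by ring.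
    eapply Rle_trans; [apply Cmod_triangle|]. rewrite Cmod_opp. lra. }
  assert (Hnz : forall z, Cmod (z - z0) < d' -> u z <> 0%C).
  { intros z Hz E. specialize (Hlow z Hz). rewrite E, Cmod_0 in Hlow. lra. }
  assert (Hinv : forall z, Cmod (z - z0) < d' -> Cmod (/ u z) <= / e).
  { intros z Hz. rewrite Cmod_inv by auto. apply Rinv_le_contravar; auto. }
  assert (Hz00 : Cmod (z0 - z0) < d').
  { replace (z0 - z0)%C with (RtoC 0) by ring. rewrite Cmod_0. exact Hd'. }
  assert (HV : 0 < / e) by (apply Rinv_0_lt_compat, He).
  assert (Hdif : forall z, Cmod (z - z0) < d' ->
     Cmod (/ u z - / u z0) <= L * Cmod (z - z0) * (/ e * / e)).
  { intros z Hz.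
    replace (/ u z - / u z0)%C with (- (u z - u z0) * (/ u z * / u z0))%C
      by (field; auto).
    rewrite !Cmod_mult, Cmod_opp.
    apply Rmult_le_compat; try apply Cmod_ge_0.
    - apply Rmult_le_pos; apply Cmod_ge_0.
    - apply HLip; lra.
    - apply Rmult_le_compat; try apply Cmod_ge_0; auto. }
  set (V := / e) in *.
  assert (hl := Cmod_ge_0 l).
  exists (K * (V * V) + Cmod l * (V * (L * (V * V)))), d'.
  split; [|split; [exact Hd'|]].
  { assert (0 < V * V) by (apply Rmult_lt_0_compat; lra).
    assert (0 < K * (V * V)) by (apply Rmult_lt_0_compat; lra).
    assert (0 <= Cmod l * (V * (L * (V * V)))); [|lra].
    repeat (apply Rmult_le_pos; try lra). }
  intros y z Hy Hz.
  specialize (H y z ltac:(lra) ltac:(lra)).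
  replace (_ - _)%C with
    (- (u z - u y - l * (z - y)) * (/ u z * / u y)
     + l * (/ u z * - (/ u y - / u z0) + / u z0 * - (/ u z - / u z0)) * (z - y))%C
    by (field; auto).
  eapply Rle_trans; [apply Cmod_triangle|]. rewrite !Cmod_mult, Cmod_opp.
  set (a := Cmod (y - z0)) in *. set (b := Cmod (z - z0)) in *.
  set (t := Cmod (z - y)) in *.
  assert (ha : 0 <= a) by apply Cmod_ge_0. assert (hb : 0 <= b) by apply Cmod_ge_0.
  assert (ht : 0 <= t) by apply Cmod_ge_0.
  assert (H1 : Cmod (u z - u y - l * (z - y)) * (Cmod (/ u z) * Cmod (/ u y))
    <= K * (a + b) * t * (V * V)).
  { apply Rmult_le_compat; try apply Cmod_ge_0; [| exact H|].
    - apply Rmult_le_pos; apply Cmod_ge_0.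
    - apply Rmult_le_compat; try apply Cmod_ge_0; auto. }
  assert (H2 : Cmod (/ u z * - (/ u y - / u z0) + / u z0 * - (/ u z - / u z0))
    <= V * (L * a * (V * V)) + V * (L * b * (V * V))).
  { eapply Rle_trans; [apply Cmod_triangle|]. rewrite !Cmod_mult, !Cmod_opp.
    apply Rplus_le_compat; apply Rmult_le_compat; try apply Cmod_ge_0; auto;
      apply Hdif; assumption. }
  assert (H3 : Cmod l * Cmod (/ u z * - (/ u y - / u z0) + / u z0 * - (/ u z - / u z0)) * t
    <= Cmod l * (V * (L * a * (V * V)) + V * (L * b * (V * V))) * t).
  { apply Rmult_le_compat_r; [exact ht|]. apply Rmult_le_compat_l; auto. }
  lra.
Qed.

(** * Derivatives of plane curves *)

Definition cis (x : R) : C := (cos x, sin x).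

(** Real differentiability of a complex-valued curve is stated on the two real
    components because the integrals below are integrals of real functions. *)
Definition curve_derive (A : R -> C) (t : R) (A' : C) : Prop :=
  is_derive (fun s => Re (A s)) t (Re A') /\ is_derive (fun s => Im (A s)) t (Im A').

Lemma cis_plus (x y : R) : cis (x + y) = (cis x * cis y)%C.
Proof.
  unfold cis, Cmult. simpl. rewrite cos_plus, sin_plus. f_equal; ring.
Qed.

Lemma cis_pow (x : R) (k : nat) : (cis x ^ k)%C = cis (INR k * x).
Proof.
  induction k as [|k IH].
  - simpl. rewrite Rmult_0_l. unfold cis. rewrite cos_0, sin_0. reflexivity.
  - rewrite Cpow_S, IH, <- cis_plus, S_INR. f_equal. ring.
Qed.

Lemma Cmod_cis (x : R) : Cmod (cis x) = 1.
Proof.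
  unfold Cmod, cis. simpl. rewrite !Rmult_1_r.
  rewrite Rplus_comm.
  change (sin x * sin x + cos x * cos x) with (Rsqr (sin x) + Rsqr (cos x)).
  rewrite sin2_cos2. apply sqrt_1.
Qed.

Lemma cis_opp (x : R) : cis (- x) = Cconj (cis x).
Proof. unfold cis, Cconj. simpl. rewrite cos_neg, sin_neg. reflexivity. Qed.

Lemma cis_full_turns (j : Z) : cis (IZR j * (2 * PI)) = 1%C.
Proof.
  assert (H : forall k : nat, cis (INR k * (2 * PI)) = 1%C).
  { intros k. unfold cis.
    replace (INR k * (2 * PI)) with (0 + 2 * INR k * PI) by ring.
    rewrite cos_period, sin_period, cos_0, sin_0. reflexivity. }
  destruct (Z.le_gt_cases 0 j) as [Hj|Hj].
  - rewrite <- (Z2Nat.id j Hj), <- INR_IZR_INZ. apply H.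
  - replace (IZR j * (2 * PI)) with (- (INR (Z.to_nat (- j)) * (2 * PI))).
    + rewrite cis_opp, H. unfold Cconj. simpl. rewrite Ropp_0. reflexivity.
    + rewrite INR_IZR_INZ, Z2Nat.id by lia. rewrite opp_IZR. ring.
Qed.

Lemma Cmod_Re_Im_le (z : C) : Cmod z <= Rabs (Re z) + Rabs (Im z).
Proof.
  destruct z as [x y]. simpl.
  replace (x, y) with (RtoC x + RtoC y * Ci)%C.
  - eapply Rle_trans; [apply Cmod_triangle|].
    rewrite Cmod_mult, Cmod_Ci, !Cmod_R. lra.
  - unfold Cplus, Cmult, RtoC, Ci. simpl. f_equal; ring.
Qed.

Lemma Im_le_Cmod (z : C) : Rabs (Im z) <= Cmod z.
Proof. eapply Rle_trans; [apply Rmax_r|apply Rmax_Cmod]. Qed.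

Lemma is_derive_R_approx (f : R -> R) (t l : R) :
  is_derive f t l <->
  forall eps, 0 < eps -> exists delta, 0 < delta /\ forall h, Rabs h < delta ->
    Rabs (f (t + h) - f t - h * l) <= eps * Rabs h.
Proof.
  rewrite is_derive_Reals. split.
  - intros H eps Heps. destruct (H eps Heps) as [d Hd].
    exists d. split; [apply cond_pos|]. intros h Hh.
    destruct (Req_dec h 0) as [->|Hn].
    + rewrite Rplus_0_r, Rabs_R0.
      replace (f t - f t - 0 * l) with 0 by ring. rewrite Rabs_R0. lra.
    + specialize (Hd h Hn Hh).
      replace (f (t + h) - f t - h * l) with (((f (t + h) - f t) / h - l) * h)
        by (field; exact Hn).
      rewrite Rabs_mult. apply Rmult_le_compat_r; [apply Rabs_pos|lra].
  - intros H eps Heps. destruct (H (eps / 2) ltac:(lra)) as [d [Hd Hh]].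
    exists (mkposreal d Hd). intros h Hn Hlt. specialize (Hh h Hlt).
    replace ((f (t + h) - f t) / h - l) with ((f (t + h) - f t - h * l) / h)
      by (field; exact Hn).
    unfold Rdiv. rewrite Rabs_mult, Rabs_inv.
    assert (Hp := Rabs_pos_lt h Hn).
    apply Rle_lt_trans with (eps / 2); [|lra].
    apply Rle_div_l; assumption.
Qed.

Lemma curve_derive_approx (A : R -> C) (t : R) (A' : C) :
  curve_derive A t A' <->
  forall eps, 0 < eps -> exists delta, 0 < delta /\ forall h, Rabs h < delta ->
    Cmod (A (t + h)%R - A t - RtoC h * A') <= eps * Rabs h.
Proof.
  assert (HRe : forall h : R, Re (A (t + h)%R - A t - RtoC h * A')%C
                 = Re (A (t + h)%R) - Re (A t) - h * Re A').
  { intros h. unfold Re, Cminus, Cplus, Copp, Cmult, RtoC. simpl. ring. }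
  assert (HIm : forall h : R, Im (A (t + h)%R - A t - RtoC h * A')%C
                 = Im (A (t + h)%R) - Im (A t) - h * Im A').
  { intros h. unfold Im, Cminus, Cplus, Copp, Cmult, RtoC. simpl. ring. }
  unfold curve_derive. rewrite !is_derive_R_approx. split.
  - intros [H1 H2] eps Heps.
    destruct (H1 (eps / 2) ltac:(lra)) as [d1 [Hd1 K1]].
    destruct (H2 (eps / 2) ltac:(lra)) as [d2 [Hd2 K2]].
    exists (Rmin d1 d2). split; [apply Rmin_pos; assumption|]. intros h Hh.
    eapply Rle_trans; [apply Cmod_Re_Im_le|]. rewrite HRe, HIm.
    specialize (K1 h (Rlt_le_trans _ _ _ Hh (Rmin_l _ _))).
    specialize (K2 h (Rlt_le_trans _ _ _ Hh (Rmin_r _ _))). lra.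
  - intros H. split; intros eps Heps; destruct (H eps Heps) as [d [Hd K]];
      exists d; (split; [exact Hd|]); intros h Hh; specialize (K h Hh).
    + rewrite <- HRe. eapply Rle_trans; [apply re_le_Cmod|exact K].
    + rewrite <- HIm. eapply Rle_trans; [apply Im_le_Cmod|exact K].
Qed.

(** The chain rule mixes the complex derivative of [P] with the real derivative of
    the curve; the quadratic error of [P] is negligible since the curve is
    Lipschitz at [t]. *)
Lemma curve_derive_comp (P : C -> C) (A : R -> C) (t : R) (A' l : C) :
  strict_diff P (A t) l -> curve_derive A t A' ->
  curve_derive (fun s => P (A s)) t (l * A').
Proof.
  intros HP HA. rewrite curve_derive_approx in HA |- *. intros eps Heps.
  destruct (strict_diff_quadratic P _ l HP) as [K [d [HK [Hd Hq]]]].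
  assert (hl := Cmod_ge_0 l). assert (hA := Cmod_ge_0 A').
  pose (e := Rmin 1 (eps / (2 * (Cmod l + 1)))).
  assert (He : 0 < e) by (apply Rmin_pos; [lra|apply Rdiv_lt_0_compat; lra]).
  assert (He1 : e <= 1) by apply Rmin_l.
  assert (He2 : e <= eps / (2 * (Cmod l + 1))) by apply Rmin_r.
  apply Rle_div_r in He2; [|lra].
  destruct (HA e He) as [d1 [Hd1 H1]].
  pose (L := Cmod A' + 1).
  assert (HL : 0 < L) by (unfold L; lra).
  assert (HKL : 0 < 2 * K * L * L) by (repeat apply Rmult_lt_0_compat; lra).
  exists (Rmin d1 (Rmin (d / L) (eps / (2 * K * L * L)))). split.
  { repeat apply Rmin_pos; try apply Rdiv_lt_0_compat; lra. }
  intros h Hh.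
  assert (Hh1 := Rlt_le_trans _ _ _ Hh (Rmin_l _ _)).
  assert (Hh' := Rlt_le_trans _ _ _ Hh (Rmin_r _ _)).
  assert (Hh2 := Rlt_le_trans _ _ _ Hh' (Rmin_l _ _)).
  assert (Hh3 := Rlt_le_trans _ _ _ Hh' (Rmin_r _ _)).
  apply Rlt_div_r in Hh2; [|exact HL]. apply Rlt_div_r in Hh3; [|exact HKL].
  specialize (H1 h Hh1). assert (hp := Rabs_pos h).
  set (w := (A (t + h)%R - A t)%C) in *.
  assert (Hw : Cmod w <= L * Rabs h).
  { replace w with (w - RtoC h * A' + RtoC h * A')%C by ring.
    eapply Rle_trans; [apply Cmod_triangle|]. rewrite Cmod_mult, Cmod_R.
    unfold L. assert (e * Rabs h <= 1 * Rabs h) by (apply Rmult_le_compat_r; lra).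
    lra. }
  specialize (Hq w ltac:(lra)).
  replace (A t + w)%C with (A (t + h)%R) in Hq by (unfold w; ring).
  replace (P (A (t + h)%R) - P (A t) - RtoC h * (l * A'))%C
    with (P (A (t + h)%R) - P (A t) - l * w + l * (w - RtoC h * A'))%C by ring.
  eapply Rle_trans; [apply Cmod_triangle|]. rewrite Cmod_mult.
  assert (hw := Cmod_ge_0 w).
  assert (Q1 : K * Cmod w ^ 2 <= eps / 2 * Rabs h).
  { apply Rle_trans with (K * (L * Rabs h) ^ 2).
    - apply Rmult_le_compat_l; [lra|]. apply pow_incr; lra.
    - replace (K * (L * Rabs h) ^ 2) with (K * L * L * Rabs h * Rabs h) by ring.
      apply Rmult_le_compat_r; lra. }
  assert (Q2 : Cmod l * Cmod (w - RtoC h * A') <= eps / 2 * Rabs h).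
  { apply Rle_trans with (Cmod l * (e * Rabs h)).
    - apply Rmult_le_compat_l; assumption.
    - rewrite <- Rmult_assoc. apply Rmult_le_compat_r; lra. }
  lra.
Qed.

Lemma curve_derive_mult (A B : R -> C) (t : R) (A' B' : C) :
  curve_derive A t A' -> curve_derive B t B' ->
  curve_derive (fun s => A s * B s)%C t (A' * B t + A t * B')%C.
Proof.
  unfold curve_derive. rewrite !is_derive_Reals.
  intros [A1 A2] [B1 B2].
  assert (H11 := derivable_pt_lim_mult _ _ _ _ _ A1 B1).
  assert (H22 := derivable_pt_lim_mult _ _ _ _ _ A2 B2).
  assert (H12 := derivable_pt_lim_mult _ _ _ _ _ A1 B2).
  assert (H21 := derivable_pt_lim_mult _ _ _ _ _ A2 B1).
  split.
  - replace (Re (A' * B t + A t * B')%C) with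
      (Re A' * Re (B t) + Re (A t) * Re B' - (Im A' * Im (B t) + Im (A t) * Im B'))
      by (unfold Re, Im, Cmult, Cplus; simpl; ring).
    exact (derivable_pt_lim_minus _ _ _ _ _ H11 H22).
  - replace (Im (A' * B t + A t * B')%C) with
      (Re A' * Im (B t) + Re (A t) * Im B' + (Im A' * Re (B t) + Im (A t) * Re B'))
      by (unfold Re, Im, Cmult, Cplus; simpl; ring).
    exact (derivable_pt_lim_plus _ _ _ _ _ H12 H21).
Qed.

Lemma curve_derive_const (a : C) (t : R) : curve_derive (fun _ => a) t 0%C.
Proof. split; apply @is_derive_const. Qed.

Lemma curve_derive_RtoC (t : R) : curve_derive (fun s => RtoC s) t 1%C.
Proof.
  unfold curve_derive. rewrite !is_derive_Reals.
  split; [apply derivable_pt_lim_id|apply derivable_pt_lim_const].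
Qed.

Lemma curve_derive_cis (m t : R) :
  curve_derive (fun s => cis (m * s)) t (Ci * RtoC m * cis (m * t))%C.
Proof.
  split; unfold cis, Ci, RtoC, Cmult, Re, Im; simpl; auto_derive; auto; ring.
Qed.

Lemma curve_derive_continuous (A : R -> C) (t : R) (A' : C) :
  curve_derive A t A' ->
  continuous (fun s => Re (A s)) t /\ continuous (fun s => Im (A s)) t.
Proof.
  intros [H1 H2]. split; apply @ex_derive_continuous; eexists; eassumption.
Qed.

(** * Fourier coefficients on circles *)

Definition circle (r t : R) : C := (RtoC r * cis t)%C.

Definition wave (kappa : C) (j : Z) (t : R) : C := (kappa * cis (- IZR j * t))%C.

(** Up to the factor [2 pi], the real part of [kappa] times the [j]-th Fourier
    coefficient of [P] on the circle of radius [r]. *)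
Definition harmonic (P : C -> C) (kappa : C) (j : Z) (r : R) : R :=
  RInt (fun t => Re (P (circle r t) * wave kappa j t)%C) 0 (2 * PI).

Lemma Cmod_circle (r t : R) : 0 <= r -> Cmod (circle r t) = r.
Proof.
  intros Hr. unfold circle. rewrite Cmod_mult, Cmod_cis, Cmod_R.
  rewrite Rabs_pos_eq; lra.
Qed.

Lemma Cmod_wave (kappa : C) (j : Z) (t : R) : Cmod (wave kappa j t) = Cmod kappa.
Proof. unfold wave. rewrite Cmod_mult, Cmod_cis. ring. Qed.

Lemma curve_derive_ext (A B : R -> C) (t : R) (A' B' : C) :
  (forall s, A s = B s) -> A' = B' -> curve_derive A t A' -> curve_derive B t B'.
Proof.
  intros E <- [H1 H2].
  split; (eapply is_derive_ext; [|eassumption]); intros s; cbv beta; rewrite E; reflexivity.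
Qed.

Lemma curve_derive_wave (kappa : C) (j : Z) (t : R) :
  curve_derive (wave kappa j) t (- Ci * RtoC (IZR j) * wave kappa j t)%C.
Proof.
  refine (curve_derive_ext _ _ _ _ _ _ _
            (curve_derive_mult _ _ _ _ _ (curve_derive_const kappa t)
               (curve_derive_cis (- IZR j) t))).
  - reflexivity.
  - unfold wave. rewrite RtoC_opp. ring.
Qed.

Lemma curve_derive_circle_angle (r t : R) :
  curve_derive (circle r) t (Ci * circle r t)%C.
Proof.
  refine (curve_derive_ext _ _ _ _ _ _ _
            (curve_derive_mult _ _ _ _ _ (curve_derive_const (RtoC r) t)
               (curve_derive_cis 1 t))).
  - intros s. unfold circle. rewrite Rmult_1_l. reflexivity.
  - unfold circle. rewrite Rmult_1_l. ring.
Qed.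

Lemma curve_derive_circle_radius (r t : R) :
  curve_derive (fun u => circle u t) r (cis t).
Proof.
  refine (curve_derive_ext _ _ _ _ _ _ _
            (curve_derive_mult _ _ _ _ _ (curve_derive_RtoC r)
               (curve_derive_const (cis t) r))).
  - reflexivity.
  - ring.
Qed.

Definition continuous_2d (A : R -> R -> C) (x y : R) : Prop :=
  continuity_2d_pt (fun u v => Re (A u v)) x y /\
  continuity_2d_pt (fun u v => Im (A u v)) x y.

Lemma continuous_2d_mult (A B : R -> R -> C) (x y : R) :
  continuous_2d A x y -> continuous_2d B x y ->
  continuous_2d (fun u v => A u v * B u v)%C x y.
Proof.
  intros [A1 A2] [B1 B2]. split.
  - exact (continuity_2d_pt_minus _ _ _ _ (continuity_2d_pt_mult _ _ _ _ A1 B1)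
             (continuity_2d_pt_mult _ _ _ _ A2 B2)).
  - exact (continuity_2d_pt_plus _ _ _ _ (continuity_2d_pt_mult _ _ _ _ A1 B2)
             (continuity_2d_pt_mult _ _ _ _ A2 B1)).
Qed.

Lemma continuous_2d_const (a : C) (x y : R) : continuous_2d (fun _ _ => a) x y.
Proof. split; apply continuity_2d_pt_const. Qed.

Lemma continuous_2d_cis (m x y : R) : continuous_2d (fun _ v => cis (m * v)) x y.
Proof.
  assert (H : continuity_2d_pt (fun _ v => m * v) x y)
    by (apply continuity_2d_pt_mult;
        [apply continuity_2d_pt_const|apply continuity_2d_pt_id2]).
  split.
  - apply (continuity_1d_2d_pt_comp cos (fun _ v => m * v)); [|exact H].
    apply continuity_cos.
  - apply (continuity_1d_2d_pt_comp sin (fun _ v => m * v)); [|exact H].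
    apply continuity_sin.
Qed.

Lemma continuous_2d_ext (A B : R -> R -> C) (x y : R) :
  (forall u v, A u v = B u v) -> continuous_2d A x y -> continuous_2d B x y.
Proof.
  intros E [H1 H2].
  split; [refine (continuity_2d_pt_ext _ _ _ _ _ H1)
    |refine (continuity_2d_pt_ext _ _ _ _ _ H2)];
    intros; cbv beta; rewrite E; reflexivity.
Qed.

Lemma continuous_2d_circle (x y : R) : continuous_2d circle x y.
Proof.
  apply (continuous_2d_ext (fun u v => RtoC u * cis (1 * v))%C).
  { intros u v. unfold circle. rewrite Rmult_1_l. reflexivity. }
  apply continuous_2d_mult; [|apply continuous_2d_cis].
  split; [apply continuity_2d_pt_id1|exact (continuity_2d_pt_const x y 0)].
Qed.

Lemma continuous_2d_wave (kappa : C) (j : Z) (x y : R) :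
  continuous_2d (fun _ v => wave kappa j v) x y.
Proof. apply continuous_2d_mult; [apply continuous_2d_const|apply continuous_2d_cis]. Qed.

Lemma continuous_2d_comp (D : C -> C) (A : R -> R -> C) (x y L delta : R) :
  0 < L -> 0 < delta ->
  (forall z, Cmod (z - A x y) < delta ->
     Cmod (D z - D (A x y)) <= L * Cmod (z - A x y)) ->
  continuous_2d A x y -> continuous_2d (fun u v => D (A u v)) x y.
Proof.
  intros HL Hd HD [A1 A2].
  assert (K : forall eps : posreal,
    locally_2d (fun u v => Cmod (D (A u v) - D (A x y)) < eps) x y).
  { intros eps.
    pose (e := Rmin (delta / 2) (eps / L / 4)).
    assert (He0 : 0 < eps / L) by (apply Rdiv_lt_0_compat; [apply cond_pos|exact HL]).
    assert (He : 0 < e) by (apply Rmin_pos; lra).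
    assert (He1 : e <= delta / 2) by apply Rmin_l.
    assert (He2 : e <= eps / L / 4) by apply Rmin_r.
    destruct (A1 (mkposreal e He)) as [d1 H1]. destruct (A2 (mkposreal e He)) as [d2 H2].
    exists (mkposreal _ (Rmin_pos _ _ (cond_pos d1) (cond_pos d2))).
    intros u v Hu Hv. simpl in Hu, Hv, H1, H2.
    specialize (H1 u v (Rlt_le_trans _ _ _ Hu (Rmin_l _ _))
                       (Rlt_le_trans _ _ _ Hv (Rmin_l _ _))).
    specialize (H2 u v (Rlt_le_trans _ _ _ Hu (Rmin_r _ _))
                       (Rlt_le_trans _ _ _ Hv (Rmin_r _ _))).
    assert (HA : Cmod (A u v - A x y) < 2 * e).
    { eapply Rle_lt_trans; [apply Cmod_Re_Im_le|].
      unfold Re, Im, Cminus, Cplus, Copp in *. simpl. unfold Rminus in *. lra. }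
    eapply Rle_lt_trans; [apply HD; lra|].
    assert (Hlt : Cmod (A u v - A x y) < eps / L) by lra.
    apply Rlt_div_r in Hlt; lra. }
  split; intros eps; destruct (K eps) as [d Hd']; exists d; intros u v Hu Hv;
    (eapply Rle_lt_trans; [|exact (Hd' u v Hu Hv)]).
  - apply (re_le_Cmod (D (A u v) - D (A x y))).
  - apply (Im_le_Cmod (D (A u v) - D (A x y))).
Qed.

Lemma continuity_2d_pt_slice (f : R -> R -> R) (x y : R) :
  continuity_2d_pt f x y -> continuous (fun t => f x t) y.
Proof.
  intros H. apply (proj2 (filterlim_locally _ _)). intros eps.
  destruct (H eps) as [d Hd]. exists d. intros t Ht.
  apply (Hd x t); [|exact Ht].
  unfold Rminus. rewrite Rplus_opp_r, Rabs_R0. apply cond_pos.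
Qed.

Lemma in_disk_circle (r t : R) : 0 <= r < 1 -> in_disk (circle r t).
Proof. intros H. unfold in_disk. rewrite Cmod_circle; lra. Qed.

Lemma continuous_2d_derivative (P D : C -> C) (r t : R) :
  0 <= r < 1 -> (forall z, in_disk z -> strict_diff P z (D z)) ->
  continuous_2d (fun u v => D (circle u v)) r t.
Proof.
  intros Hr HP.
  destruct (strict_diff_derivative_continuous P D (circle r t)
              (in_disk_circle r t Hr) HP) as [L [d [HL [Hd H]]]].
  apply (continuous_2d_comp D circle r t L d HL Hd);
    [intros z Hz; apply H, Hz|apply continuous_2d_circle].
Qed.

Lemma continuous_2d_strict_diff (P D : C -> C) (r t : R) :
  0 <= r < 1 -> (forall z, in_disk z -> strict_diff P z (D z)) ->
  continuous_2d (fun u v => P (circle u v)) r t.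
Proof.
  intros Hr HP.
  destruct (strict_diff_lipschitz P _ _ (HP _ (in_disk_circle r t Hr)))
    as [L [d [HL [Hd H]]]].
  apply (continuous_2d_comp P circle r t L d HL Hd H), continuous_2d_circle.
Qed.

Lemma ex_RInt_harmonic (P D : C -> C) (kappa : C) (j : Z) (r : R) :
  0 <= r < 1 -> (forall z, in_disk z -> strict_diff P z (D z)) ->
  ex_RInt (fun t => Re (P (circle r t) * wave kappa j t)%C) 0 (2 * PI).
Proof.
  intros Hr HP. apply @ex_RInt_continuous. intros t _.
  apply (continuity_2d_pt_slice (fun u v => Re (P (circle u v) * wave kappa j v)%C)).
  apply (continuous_2d_mult (fun u v => P (circle u v)) (fun _ v => wave kappa j v)).
  - apply (continuous_2d_strict_diff P D); assumption.
  - apply continuous_2d_wave.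
Qed.

(** The product rule along the angle reads
    [d/dt (P e^(-ijt)) = i (r P' e^(it) e^(-ijt) - j P e^(-ijt))], and its
    imaginary part is [r] times the radial derivative of the integrand minus [j]
    times the integrand.  The left-hand side integrates to 0 over a full turn. *)
Lemma is_derive_harmonic (P D : C -> C) (kappa : C) (j : Z) (r : R) :
  0 < r < 1 -> (forall z, in_disk z -> strict_diff P z (D z)) ->
  is_derive (harmonic P kappa j) r (IZR j / r * harmonic P kappa j r).
Proof.
  intros Hr HP.
  pose (g u v := Re (D (circle u v) * cis v * wave kappa j v)%C).
  assert (Hcurve : forall u t, 0 <= u < 1 ->
    is_derive (fun s => Re (P (circle s t) * wave kappa j t)%C) u (g u t)).
  { intros u t Hu.
    assert (H := curve_derive_mult _ _ _ _ _
      (curve_derive_comp P (fun s => circle s t) u _ _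
         (HP _ (in_disk_circle u t Hu)) (curve_derive_circle_radius u t))
      (curve_derive_const (wave kappa j t) u)).
    apply (curve_derive_ext _ _ _ _ (D (circle u t) * cis t * wave kappa j t)%C
             (fun s => eq_refl)) in H; [|ring].
    apply (proj1 H). }
  assert (Hg : forall t, continuity_2d_pt g r t).
  { intros t.
    apply (continuous_2d_mult (fun u v => D (circle u v) * cis v)%C
             (fun _ v => wave kappa j v)); [|apply continuous_2d_wave].
    apply (continuous_2d_mult (fun u v => D (circle u v)) (fun _ v => cis v)).
    - apply (continuous_2d_derivative P D); [lra|assumption].
    - apply (continuous_2d_ext (fun _ v => cis (1 * v)));
        [intros; rewrite Rmult_1_l; reflexivity|apply continuous_2d_cis]. }
  assert (Hloc : forall u, Rabs (u - r) < Rmin r (1 - r) -> 0 < u < 1).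
  { intros u Hu. assert (h1 := Rmin_l r (1 - r)). assert (h2 := Rmin_r r (1 - r)).
    apply Rabs_def2 in Hu. lra. }
  assert (Hm : 0 < Rmin r (1 - r)) by (apply Rmin_pos; lra).
  assert (Hpar : is_derive (harmonic P kappa j) r (RInt (fun t => g r t) 0 (2 * PI))).
  { evar_last.
    - apply (is_derive_RInt_param
               (fun u t => Re (P (circle u t) * wave kappa j t)%C) 0 (2 * PI) r).
      + exists (mkposreal _ Hm). intros u Hu t _. eexists.
        assert (0 < u < 1) by exact (Hloc u Hu). apply Hcurve. lra.
      + intros t _. apply (continuity_2d_pt_ext_loc g); [|apply Hg].
        exists (mkposreal _ Hm). intros u v Hu _.
        assert (0 < u < 1) by exact (Hloc u Hu).
        symmetry. apply is_derive_unique, Hcurve. lra.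
      + exists (mkposreal _ Hm). intros u Hu.
        assert (0 < u < 1) by exact (Hloc u Hu).
        apply (ex_RInt_harmonic P D); [lra|assumption].
    - apply RInt_ext. intros t _. apply is_derive_unique, Hcurve. lra. }
  assert (Hang : forall t, is_derive (fun s => Im (P (circle r s) * wave kappa j s)%C) t
                  (r * g r t - IZR j * Re (P (circle r t) * wave kappa j t)%C)).
  { intros t.
    assert (H := curve_derive_mult _ _ _ _ _
      (curve_derive_comp P (circle r) t _ _
         (HP _ (in_disk_circle r t ltac:(lra))) (curve_derive_circle_angle r t))
      (curve_derive_wave kappa j t)).
    evar_last; [exact (proj2 H)|].
    unfold g, circle, Ci, Re, Im, Cmult, Cplus, Copp, RtoC. simpl. ring. }
  assert (Hzero : is_RInt
    (fun t => r * g r t - IZR j * Re (P (circle r t) * wave kappa j t)%C) 0 (2 * PI) 0).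
  { evar_last.
    - apply (is_RInt_derive (fun s => Im (P (circle r s) * wave kappa j s)%C)).
      + intros t _. apply Hang.
      + intros t _.
        apply (continuity_2d_pt_slice
          (fun u v => r * g u v - IZR j * Re (P (circle u v) * wave kappa j v)%C)).
        apply continuity_2d_pt_minus; apply continuity_2d_pt_mult;
          try apply continuity_2d_pt_const; [apply Hg|].
        apply (continuous_2d_mult (fun u v => P (circle u v)) (fun _ v => wave kappa j v));
          [apply (continuous_2d_strict_diff P D); [lra|assumption]|apply continuous_2d_wave].
    - unfold circle, wave.
      replace (- IZR j * (2 * PI)) with (IZR (- j) * (2 * PI)) by (rewrite opp_IZR; ring).
      rewrite cis_full_turns.
      replace (2 * PI) with (IZR 1 * (2 * PI)) by ring. rewrite cis_full_turns.
      rewrite Rmult_0_r. replace (cis 0) with (RtoC 1)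
        by (unfold cis; rewrite cos_0, sin_0; reflexivity).
      apply (minus_eq_zero (G := R_AbelianGroup)). }
  assert (Eg : RInt (fun t => g r t) 0 (2 * PI) = IZR j / r * harmonic P kappa j r).
  { assert (Hex1 : ex_RInt (fun t => g r t) 0 (2 * PI)).
    { apply @ex_RInt_continuous. intros t _. apply (continuity_2d_pt_slice g), Hg. }
    assert (Hex2 := ex_RInt_harmonic P D kappa j r ltac:(lra) HP).
    assert (E := is_RInt_minus (V := R_CompleteNormedModule) _ _ _ _ _ _
       (is_RInt_scal _ _ _ r _ (RInt_correct (V := R_CompleteNormedModule) _ _ _ Hex1))
       (is_RInt_scal _ _ _ (IZR j) _
          (RInt_correct (V := R_CompleteNormedModule) _ _ _ Hex2))).
    apply (is_RInt_unique (V := R_CompleteNormedModule)) in E.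
    apply (is_RInt_unique (V := R_CompleteNormedModule)) in Hzero.
    assert (E' : r * RInt (fun t => g r t) 0 (2 * PI)
                 - IZR j * harmonic P kappa j r = 0)
      by exact (eq_trans (eq_sym E) Hzero).
    apply (Rmult_eq_reg_l r); [|lra].
    replace (r * (IZR j / r * harmonic P kappa j r))
      with (IZR j * harmonic P kappa j r) by (field; lra).
    lra. }
  rewrite <- Eg. exact Hpar.
Qed.

(** * Orders of vanishing at the origin *)

Definition bigO (n : nat) (h : C -> C) : Prop :=
  exists K delta, 0 < K /\ 0 < delta /\ forall z, Cmod z < delta ->
    Cmod (h z) <= K * Cmod z ^ n.

Lemma bigO_ext (n : nat) (h h' : C -> C) :
  (forall z, h z = h' z) -> bigO n h -> bigO n h'.
Proof.
  intros E [K [d [HK [Hd H]]]]. exists K, d. split; [exact HK|split; [exact Hd|]].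
  intros z Hz. rewrite <- E. auto.
Qed.

Lemma bigO_plus (n : nat) (h k : C -> C) :
  bigO n h -> bigO n k -> bigO n (fun z => h z + k z)%C.
Proof.
  intros [K1 [d1 [HK1 [Hd1 H1]]]] [K2 [d2 [HK2 [Hd2 H2]]]].
  exists (K1 + K2), (Rmin d1 d2).
  split; [lra|split; [apply Rmin_pos; assumption|]]. intros z Hz.
  specialize (H1 z (Rlt_le_trans _ _ _ Hz (Rmin_l _ _))).
  specialize (H2 z (Rlt_le_trans _ _ _ Hz (Rmin_r _ _))).
  eapply Rle_trans; [apply Cmod_triangle|]. lra.
Qed.

Lemma bigO_mult (n m : nat) (h k : C -> C) :
  bigO n h -> bigO m k -> bigO (n + m) (fun z => h z * k z)%C.
Proof.
  intros [K1 [d1 [HK1 [Hd1 H1]]]] [K2 [d2 [HK2 [Hd2 H2]]]].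
  exists (K1 * K2), (Rmin d1 d2).
  split; [apply Rmult_lt_0_compat; assumption|split; [apply Rmin_pos; assumption|]].
  intros z Hz.
  specialize (H1 z (Rlt_le_trans _ _ _ Hz (Rmin_l _ _))).
  specialize (H2 z (Rlt_le_trans _ _ _ Hz (Rmin_r _ _))).
  rewrite Cmod_mult, pow_add.
  replace (K1 * K2 * (Cmod z ^ n * Cmod z ^ m))
    with (K1 * Cmod z ^ n * (K2 * Cmod z ^ m)) by ring.
  apply Rmult_le_compat; auto using Cmod_ge_0.
Qed.

Lemma bigO_const (a : C) : bigO 0 (fun _ => a).
Proof.
  assert (h := Cmod_ge_0 a).
  exists (Cmod a + 1), 1. split; [lra|split; [lra|]]. intros z _. simpl. lra.
Qed.

Lemma bigO_scal (n : nat) (a : C) (h : C -> C) :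
  bigO n h -> bigO n (fun z => a * h z)%C.
Proof. apply (bigO_mult 0 n), bigO_const. Qed.

Lemma bigO_pow (n : nat) : bigO n (fun z => z ^ n)%C.
Proof.
  exists 1, 1. split; [lra|split; [lra|]]. intros z _. rewrite Cmod_pow. lra.
Qed.

Lemma bigO_id : bigO 1 (fun z => z).
Proof. apply (bigO_ext 1 (fun z => z ^ 1)%C); [intros; simpl; ring|apply bigO_pow]. Qed.

Lemma bigO_weaken (n m : nat) (h : C -> C) : (n <= m)%nat -> bigO m h -> bigO n h.
Proof.
  intros Hnm [K [d [HK [Hd H]]]]. exists K, (Rmin 1 d).
  split; [exact HK|split; [apply Rmin_pos; lra|]]. intros z Hz.
  assert (Hz1 := Rlt_le_trans _ _ _ Hz (Rmin_l _ _)).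
  specialize (H z (Rlt_le_trans _ _ _ Hz (Rmin_r _ _))).
  eapply Rle_trans; [exact H|]. apply Rmult_le_compat_l; [lra|].
  replace m with (n + (m - n))%nat by lia. rewrite pow_add.
  assert (hz := Cmod_ge_0 z).
  assert (Cmod z ^ (m - n) <= 1).
  { rewrite <- (pow1 (m - n)). apply pow_incr. lra. }
  rewrite <- (Rmult_1_r (Cmod z ^ n)) at 2.
  apply Rmult_le_compat_l; [apply pow_le, hz|assumption].
Qed.

Lemma bigO_comp (n : nat) (h u : C -> C) :
  bigO n h -> bigO 1 u -> bigO n (fun z => h (u z)).
Proof.
  intros [K1 [d1 [HK1 [Hd1 H1]]]] [K2 [d2 [HK2 [Hd2 H2]]]].
  exists (K1 * K2 ^ n), (Rmin d2 (d1 / K2)).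
  split; [apply Rmult_lt_0_compat; [|apply pow_lt]; assumption|].
  split; [apply Rmin_pos; [|apply Rdiv_lt_0_compat]; assumption|]. intros z Hz.
  specialize (H2 z (Rlt_le_trans _ _ _ Hz (Rmin_l _ _))).
  assert (Hz2 := Rlt_le_trans _ _ _ Hz (Rmin_r _ _)).
  apply Rlt_div_r in Hz2; [|exact HK2]. rewrite pow_1 in H2.
  eapply Rle_trans; [apply H1; lra|].
  rewrite Rmult_assoc, <- Rpow_mult_distr. apply Rmult_le_compat_l; [lra|].
  apply pow_incr. split; [apply Cmod_ge_0|exact H2].
Qed.

Lemma bigO_taylor_poly (c : nat -> C) (N : nat) : bigO 0 (taylor_poly c N).
Proof.
  induction N as [|N IH]; [apply bigO_const|].
  apply (bigO_plus 0 _ _ IH), bigO_scal.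
  apply (bigO_weaken 0 (S N)); [lia|apply bigO_pow].
Qed.

(** The coefficients vanish from the top down: modulo terms of order [N + 1] the
    top monomial can be dropped, which gives the lower coefficients by induction,
    and then the top monomial alone is of too high an order. *)
Lemma bigO_taylor_poly_zero (c : nat -> C) (N : nat) :
  bigO (S N) (taylor_poly c N) -> forall k, (k <= N)%nat -> c k = 0%C.
Proof.
  assert (Htop : forall (n : nat) (a : C), bigO (S n) (fun z => a * z ^ n)%C -> a = 0%C).
  { intros n a [K [d [HK [Hd H]]]]. apply Cmod_eq_0.
    apply Rle_antisym; [|apply Cmod_ge_0].
    apply Rnot_lt_le. intros Ha.
    pose (t := Rmin (d / 2) (Cmod a / K / 2)).
    assert (HaK : 0 < Cmod a / K) by (apply Rdiv_lt_0_compat; assumption).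
    assert (Ht : 0 < t) by (apply Rmin_pos; lra).
    assert (Ht1 : t <= d / 2) by apply Rmin_l.
    assert (Ht2 : t < Cmod a / K) by (assert (t <= Cmod a / K / 2) by apply Rmin_r; lra).
    assert (HtC : Cmod (RtoC t) = t) by (rewrite Cmod_R; apply Rabs_pos_eq; lra).
    specialize (H (RtoC t)). rewrite Cmod_mult, Cmod_pow, HtC in H.
    specialize (H ltac:(lra)). simpl pow in H. rewrite <- Rmult_assoc in H.
    apply Rmult_le_reg_r in H; [|apply pow_lt, Ht].
    apply Rlt_div_r in Ht2; lra. }
  induction N as [|N IH]; intros H k Hk.
  - replace k with O by lia. apply (Htop O).
    apply (bigO_ext 1 (taylor_poly c 0)); [intros z; simpl; ring|exact H].
  - assert (IH' : forall k, (k <= N)%nat -> c k = 0%C).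
    { apply IH.
      apply (bigO_ext (S N) (fun z => taylor_poly c (S N) z + (- c (S N)) * z ^ S N)%C).
      - intros z. cbn [taylor_poly]. ring.
      - apply bigO_plus; [apply (bigO_weaken (S N) (S (S N))); [lia|exact H]|].
        apply bigO_scal, bigO_pow. }
    destruct (Nat.eq_dec k (S N)) as [->|Hne]; [|apply IH'; lia].
    apply (Htop (S N)). apply (bigO_ext (S (S N)) (taylor_poly c (S N))); [|exact H].
    assert (Hz : forall n, (n <= N)%nat -> forall z, taylor_poly c n z = 0%C).
    { induction n as [|n IHn]; intros Hn z; cbn [taylor_poly].
      - apply IH'; lia.
      - rewrite IHn, IH' by lia. ring. }
    intros z. cbn [taylor_poly]. rewrite Hz by lia. ring.
Qed.

Lemma bigO_taylor_remainder (f : C -> C) (c : nat -> C) (r : R) (N : nat) :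
  0 < r -> (forall u, Cmod u < r -> is_pseries c u (f u)) ->
  bigO (S N) (fun z => f z - taylor_poly c N z)%C.
Proof.
  intros Hr Hf.
  destruct (taylor_remainder_lipschitz c r f N Hr Hf) as [K [d [HK [Hd H]]]].
  assert (Hf0 : f 0%C = c O).
  { apply is_pseries_at_0, Hf. rewrite Cmod_0. exact Hr. }
  exists K, d. split; [exact HK|split; [lra|]]. intros z Hz.
  specialize (H (Cmod z) 0%C z ltac:(lra)).
  rewrite Cmod_0, taylor_poly_at_0, Hf0 in H.
  specialize (H (Cmod_ge_0 z) (Rle_refl _)).
  replace (z - 0)%C with z in H by ring.
  replace (f z - c O - (taylor_poly c N z - c O))%C
    with (f z - taylor_poly c N z)%C in H by ring.
  simpl pow. lra.
Qed.

(** * The bound for functions with nonnegative real part *)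

Lemma is_RInt_harmonic_cis (b : C) (m : Z) :
  m <> 0%Z -> is_RInt (fun t => Re (b * cis (IZR m * t))%C) 0 (2 * PI) 0.
Proof.
  intros Hm. assert (Hm' : IZR m <> 0) by (apply eq_IZR_contrapositive; exact Hm).
  assert (Hd : forall t, curve_derive (fun s => b * cis (IZR m * s))%C t
                           (b * (Ci * RtoC (IZR m) * cis (IZR m * t)))%C).
  { intros t. refine (curve_derive_ext _ _ _ _ _ (fun s => eq_refl) _
      (curve_derive_mult _ _ _ _ _ (curve_derive_const b t) (curve_derive_cis (IZR m) t))).
    ring. }
  evar_last.
  - apply (is_RInt_derive (V := R_CompleteNormedModule)
      (fun t => / IZR m * Im (b * cis (IZR m * t))%C)).
    + intros t _. evar_last.
      * apply is_derive_scal, (proj2 (Hd t)).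
      * unfold Im, Re, Cmult, Ci, RtoC. simpl. field. exact Hm'.
    + intros t _. apply (proj1 (curve_derive_continuous _ _ _ (Hd t))).
  - rewrite cis_full_turns, Rmult_0_r. unfold cis. rewrite cos_0, sin_0.
    apply (minus_eq_zero (G := R_AbelianGroup)).
Qed.

Lemma circle_pow_wave (kappa : C) (j : Z) (k : nat) (r t : R) :
  (circle r t ^ k * wave kappa j t
   = RtoC (r ^ k) * kappa * cis (IZR (Z.of_nat k - j) * t))%C.
Proof.
  unfold circle, wave. rewrite Cpow_mult_l, cis_pow, <- RtoC_pow.
  rewrite minus_IZR, <- INR_IZR_INZ.
  replace ((INR k - IZR j) * t) with (INR k * t + - IZR j * t) by ring.
  rewrite cis_plus. ring.
Qed.

Lemma is_RInt_harmonic_monomial_off (a kappa : C) (j : Z) (k : nat) (r : R) :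
  j <> Z.of_nat k ->
  is_RInt (fun t => Re (a * circle r t ^ k * wave kappa j t)%C) 0 (2 * PI) 0.
Proof.
  intros Hj.
  apply (is_RInt_ext (fun t =>
    Re (a * (RtoC (r ^ k) * kappa) * cis (IZR (Z.of_nat k - j) * t))%C)).
  - intros t _. rewrite <- Cmult_assoc, <- circle_pow_wave. f_equal. ring.
  - apply is_RInt_harmonic_cis. lia.
Qed.

Lemma is_RInt_harmonic_monomial (a kappa : C) (k : nat) (r : R) :
  is_RInt (fun t => Re (a * circle r t ^ k * wave kappa (Z.of_nat k) t)%C)
    0 (2 * PI) (2 * PI * Re (kappa * a)%C * r ^ k).
Proof.
  apply (is_RInt_ext (fun _ => r ^ k * Re (kappa * a)%C)).
  - intros t _. rewrite <- Cmult_assoc, circle_pow_wave.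
    rewrite Z.sub_diag, Rmult_0_l. unfold cis. rewrite cos_0, sin_0.
    unfold Re, Cmult, RtoC. simpl. ring.
  - evar_last; [apply @is_RInt_const|].
    unfold scal; simpl; unfold mult; simpl. ring.
Qed.

Lemma is_RInt_harmonic_taylor_off (c : nat -> C) (N : nat) (kappa : C) (j : Z) (r : R) :
  (j < 0 \/ Z.of_nat N < j)%Z ->
  is_RInt (fun t => Re (taylor_poly c N (circle r t) * wave kappa j t)%C) 0 (2 * PI) 0.
Proof.
  induction N as [|N IH]; intros Hj.
  - apply (is_RInt_ext (fun t => Re (c O * circle r t ^ 0 * wave kappa j t)%C)).
    + intros t _. cbn [taylor_poly Cpow]. rewrite Cmult_1_r. reflexivity.
    + apply is_RInt_harmonic_monomial_off. lia.
  - apply (is_RInt_ext (fun t =>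
      plus (Re (taylor_poly c N (circle r t) * wave kappa j t)%C)
           (Re (c (S N) * circle r t ^ S N * wave kappa j t)%C))).
    + intros t _. cbn [taylor_poly]. rewrite Cmult_plus_distr_r. reflexivity.
    + evar_last; [apply (is_RInt_plus (V := R_NormedModule));
        [apply IH; lia|apply is_RInt_harmonic_monomial_off; lia]|].
      unfold plus; simpl. ring.
Qed.

Lemma is_RInt_harmonic_taylor (c : nat -> C) (N n : nat) (kappa : C) (r : R) :
  (n <= N)%nat ->
  is_RInt (fun t => Re (taylor_poly c N (circle r t) * wave kappa (Z.of_nat n) t)%C)
    0 (2 * PI) (2 * PI * Re (kappa * c n)%C * r ^ n).
Proof.
  induction N as [|N IH]; intros Hn.
  - replace n with O by lia.
    apply (is_RInt_ext (fun t => Re (c O * circle r t ^ 0 * wave kappa 0 t)%C)).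
    + intros t _. cbn [taylor_poly Cpow]. rewrite Cmult_1_r. reflexivity.
    + apply (is_RInt_harmonic_monomial (c O) kappa 0).
  - apply (is_RInt_ext (fun t =>
      plus (Re (taylor_poly c N (circle r t) * wave kappa (Z.of_nat n) t)%C)
           (Re (c (S N) * circle r t ^ S N * wave kappa (Z.of_nat n) t)%C))).
    + intros t _. cbn [taylor_poly]. rewrite Cmult_plus_distr_r. reflexivity.
    + destruct (Nat.eq_dec n (S N)) as [->|Hne].
      * evar_last; [apply (is_RInt_plus (V := R_NormedModule));
          [apply is_RInt_harmonic_taylor_off; lia|apply is_RInt_harmonic_monomial]|].
        unfold plus; simpl. ring.
      * evar_last; [apply (is_RInt_plus (V := R_NormedModule));
          [apply IH; lia|apply is_RInt_harmonic_monomial_off; lia]|].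
        unfold plus; simpl. ring.
Qed.

(** The equation [I' = alpha/r I] makes [I r^(-alpha)] constant, and the expansion
    near 0 determines the constant. *)
Lemma power_law_of_derivative (I : R -> R) (alpha V B delta : R) :
  0 < delta -> 0 < B ->
  (forall r, 0 < r < 1 -> is_derive I r (alpha / r * I r)) ->
  (forall r, 0 < r < delta -> Rabs (I r - V * Rpower r alpha) <= B * r * Rpower r alpha) ->
  forall r, 0 < r < 1 -> I r = V * Rpower r alpha.
Proof.
  intros Hd HB HI Hlim r Hr.
  pose (J s := I s * Rpower s (- alpha)).
  assert (HJ : forall s, 0 < s < 1 -> is_derive J s 0).
  { intros s Hs.
    assert (E1 := proj1 (is_derive_Reals _ _ _) (HI s Hs)).
    assert (E2 : derivable_pt_lim (fun s => Rpower s (- alpha)) s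
                   (- alpha / s * Rpower s (- alpha))).
    { apply is_derive_Reals. unfold Rpower. auto_derive; [lra|]. field. lra. }
    apply is_derive_Reals.
    replace 0 with (alpha / s * I s * Rpower s (- alpha)
                    + I s * (- alpha / s * Rpower s (- alpha))) by (field; lra).
    exact (derivable_pt_lim_mult _ _ _ _ _ E1 E2). }
  assert (Hpow : forall s, Rpower s alpha * Rpower s (- alpha) = 1).
  { intros s. rewrite <- Rpower_plus, Rplus_opp_r. unfold Rpower.
    rewrite Rmult_0_l. apply exp_0. }
  assert (Hpos : forall s x, 0 < Rpower s x) by (intros; apply exp_pos).
  assert (HJV : J r = V).
  { apply Rminus_diag_uniq.
    destruct (Req_dec (J r - V) 0) as [E|Hne]; [exact E|exfalso].
    assert (Hp := Rabs_pos_lt _ Hne).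
    (* At the radius [s] the error bound [B s] is at most half of the supposed discrepancy. *)
    pose (s := Rmin (r / 2) (Rmin (delta / 2) (Rabs (J r - V) / (2 * B)))).
    assert (Hs0 : 0 < s).
    { repeat apply Rmin_pos; try lra. apply Rdiv_lt_0_compat; lra. }
    assert (Hs1 : s <= r / 2) by apply Rmin_l.
    assert (Hs2 : s <= delta / 2) by (eapply Rle_trans; [apply Rmin_r|apply Rmin_l]).
    assert (Hs3 : s <= Rabs (J r - V) / (2 * B))
      by (eapply Rle_trans; [apply Rmin_r|apply Rmin_r]).
    apply Rle_div_r in Hs3; [|lra].
    assert (Heq : J s = J r).
    { apply (eq_is_derive (V := R_NormedModule) J s r); [|lra].
      intros t Ht. apply HJ. lra. }
    assert (HJs : Rabs (J s - V) <= B * s).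
    { specialize (Hlim s ltac:(lra)). unfold J.
      replace (I s * Rpower s (- alpha) - V)
        with ((I s - V * Rpower s alpha) * Rpower s (- alpha)).
      2:{ rewrite Rmult_minus_distr_r, Rmult_assoc, Hpow. ring. }
      rewrite Rabs_mult, (Rabs_pos_eq (Rpower s (- alpha))) by (apply Rlt_le, Hpos).
      replace (B * s) with (B * s * Rpower s alpha * Rpower s (- alpha))
        by (rewrite Rmult_assoc, Hpow; ring).
      apply Rmult_le_compat_r; [apply Rlt_le, Hpos|exact Hlim]. }
    rewrite Heq in HJs. lra. }
  rewrite <- HJV. unfold J.
  rewrite Rmult_assoc, (Rmult_comm (Rpower r (- alpha))), Hpow. ring.
Qed.

(** Near 0 the function may be replaced by its Taylor polynomial with an error
    [O(r^(N+1))], which is [O(r r^j)] as [j <= N]; the power law then extends the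
    value found near 0 to all radii below 1.  Negative [j] are included, with
    [V = 0]. *)
Lemma harmonic_power_law (P D : C -> C) (N : nat) (c : nat -> C) (kappa : C)
    (j : Z) (V : R) :
  (forall z, in_disk z -> strict_diff P z (D z)) ->
  bigO (S N) (fun z => P z - taylor_poly c N z)%C -> (j <= Z.of_nat N)%Z ->
  (forall r, 0 < r ->
     is_RInt (fun t => Re (taylor_poly c N (circle r t) * wave kappa j t)%C)
       0 (2 * PI) (V * Rpower r (IZR j))) ->
  forall r, 0 < r < 1 -> harmonic P kappa j r = V * Rpower r (IZR j).
Proof.
  intros HP [K [d [HK [Hd HT]]]] Hj HV.
  assert (hk := Cmod_ge_0 kappa).
  assert (HPI := PI_RGT_0).
  pose (B := 2 * PI * (K * (Cmod kappa + 1))).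
  assert (HB : 0 < B).
  { apply Rmult_lt_0_compat; [lra|]. apply Rmult_lt_0_compat; lra. }
  apply (power_law_of_derivative _ _ _ B (Rmin 1 d)).
  - apply Rmin_pos; lra.
  - exact HB.
  - intros r Hr. apply (is_derive_harmonic P D); assumption.
  - intros r Hr.
    assert (h1 := Rmin_l 1 d). assert (h2 := Rmin_r 1 d).
    assert (Hex := ex_RInt_harmonic P D kappa j r ltac:(lra) HP).
    assert (Hm := is_RInt_minus (V := R_CompleteNormedModule) _ _ _ _ _ _
      (RInt_correct (V := R_CompleteNormedModule) _ _ _ Hex) (HV r ltac:(lra))).
    assert (Hu := is_RInt_unique (V := R_CompleteNormedModule) _ _ _ _ Hm).
    change (RInt (fun t => Re (P (circle r t) * wave kappa j t)%C
      - Re (taylor_poly c N (circle r t) * wave kappa j t)%C) 0 (2 * PI)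
      = harmonic P kappa j r - V * Rpower r (IZR j)) in Hu.
    rewrite <- Hu.
    apply Rle_trans with ((2 * PI - 0) * (K * r ^ S N * Cmod kappa)).
    + apply abs_RInt_le_const; [lra|eexists; exact Hm|].
      intros t _.
      replace (Re _ - Re _) with
        (Re ((P (circle r t) - taylor_poly c N (circle r t)) * wave kappa j t)%C)
        by (unfold Re, Cmult, Cminus, Cplus, Copp; simpl; ring).
      eapply Rle_trans; [apply re_le_Cmod|]. rewrite Cmod_mult, Cmod_wave.
      apply Rmult_le_compat_r; [exact hk|].
      specialize (HT (circle r t)). rewrite Cmod_circle in HT by lra.
      apply HT. lra.
    + assert (Hpw : r ^ N <= Rpower r (IZR j)).
      { rewrite <- Rpower_pow by lra. unfold Rpower. rewrite INR_IZR_INZ.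
        assert (Hln : ln r < 0) by (rewrite <- ln_1; apply ln_increasing; lra).
        assert (HjR := IZR_le _ _ Hj).
        assert (Hle : IZR (Z.of_nat N) * ln r <= IZR j * ln r)
          by (rewrite 2!(Rmult_comm _ (ln r)); apply Rmult_le_compat_neg_l; lra).
        destruct Hle as [Hlt|Heq];
          [apply Rlt_le, exp_increasing, Hlt|rewrite Heq; apply Rle_refl]. }
      assert (HrN : 0 < r ^ N) by (apply pow_lt; lra).
      apply Rle_trans with (B * r * r ^ N).
      * unfold B. simpl pow.
        replace ((2 * PI - 0) * (K * (r * r ^ N) * Cmod kappa))
          with (2 * PI * K * r * r ^ N * Cmod kappa) by ring.
        replace (2 * PI * (K * (Cmod kappa + 1)) * r * r ^ N)
          with (2 * PI * K * r * r ^ N * (Cmod kappa + 1)) by ring.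
        apply Rmult_le_compat_l; [|lra].
        repeat (apply Rmult_le_pos; [|lra]). lra.
      * apply Rmult_le_compat_l; [|exact Hpw]. apply Rlt_le, Rmult_lt_0_compat; lra.
Qed.

Lemma one_minus_pow_ge (x : R) (n : nat) : 0 <= x <= 1 -> 1 - INR n * x <= (1 - x) ^ n.
Proof.
  intros Hx. induction n as [|n IH]; [simpl; lra|].
  rewrite S_INR. simpl pow.
  assert (h := pos_INR n).
  assert ((1 - x) * (1 - INR n * x) <= (1 - x) * (1 - x) ^ n)
    by (apply Rmult_le_compat_l; lra).
  assert (0 <= INR n * (x * x)) by (apply Rmult_le_pos; [lra|apply Rmult_le_pos; lra]).
  lra.
Qed.

Lemma le_of_scaled_pow_le (X Y : R) (n : nat) :
  0 <= X -> (forall r, 0 < r < 1 -> r ^ n * X <= Y) -> X <= Y.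
Proof.
  intros HX H. apply Rnot_lt_le. intros Hlt.
  assert (h := pos_INR n).
  assert (hnx : 0 <= INR n * X) by (apply Rmult_le_pos; assumption).
  pose (e := Rmin (1 / 2) ((X - Y) / (2 * (INR n * X + 1)))).
  assert (He : 0 < e) by (apply Rmin_pos; [lra|apply Rdiv_lt_0_compat; lra]).
  assert (He1 : e <= 1 / 2) by apply Rmin_l.
  assert (He2 : e <= (X - Y) / (2 * (INR n * X + 1))) by apply Rmin_r.
  apply Rle_div_r in He2; [|lra].
  specialize (H (1 - e) ltac:(lra)).
  assert (Hb := one_minus_pow_ge e n ltac:(lra)).
  assert ((1 - INR n * e) * X <= (1 - e) ^ n * X) by (apply Rmult_le_compat_r; lra).
  lra.
Qed.

Lemma Cmod_as_Re (a : C) : exists kappa, Cmod kappa = 1 /\ Re (kappa * a)%C = Cmod a.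
Proof.
  destruct (Req_dec (Cmod a) 0) as [H0|Hn].
  - exists 1%C. split; [apply Cmod_1|]. apply Cmod_eq_0 in H0. subst a.
    rewrite Cmod_0, Cmult_0_r. reflexivity.
  - assert (Hp : 0 < Cmod a) by (assert (h := Cmod_ge_0 a); lra).
    exists (Cconj a * RtoC (/ Cmod a))%C. split.
    + rewrite Cmod_mult, Cmod_conj, Cmod_R, Rabs_pos_eq.
      * field. exact Hn.
      * apply Rlt_le, Rinv_0_lt_compat, Hp.
    + replace (Cconj a * RtoC (/ Cmod a) * a)%C
        with (a * Cconj a * RtoC (/ Cmod a))%C by ring.
      rewrite <- Cmod2_conj, <- RtoC_mult. simpl. field. exact Hn.
Qed.

(** With [kappa] rotating [c n] to its modulus, [2 pi r^n |c n|] is the coefficient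
    of index [n], while the one of index [-n] for the conjugate of [kappa] is 0.
    Their sum is the integral of [2 Re P(r e^(it)) Re (kappa e^(-int))], where the
    second factor is at most 1 and [Re P >= 0]; it is therefore bounded by twice
    the mean [2 pi Re (c 0)].  Finally [r] tends to 1. *)
Lemma caratheodory_coefficient_bound (P D : C -> C) (N n : nat) (c : nat -> C) :
  (forall z, in_disk z -> strict_diff P z (D z)) ->
  (forall z, in_disk z -> 0 <= Re (P z)) ->
  bigO (S N) (fun z => P z - taylor_poly c N z)%C -> (1 <= n <= N)%nat ->
  Cmod (c n) <= 2 * Re (c O).
Proof.
  intros HP Hpos HT Hn.
  destruct (Cmod_as_Re (c n)) as [kappa [Hk HRe]].
  assert (HPI := PI_RGT_0).
  apply (le_of_scaled_pow_le _ _ n); [apply Cmod_ge_0|]. intros r Hr.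
  assert (E1 : harmonic P kappa (Z.of_nat n) r = 2 * PI * Cmod (c n) * r ^ n).
  { rewrite (harmonic_power_law P D N c kappa (Z.of_nat n) (2 * PI * Cmod (c n)));
      try assumption; [| lia |].
    - rewrite <- INR_IZR_INZ, Rpower_pow by lra. reflexivity.
    - intros s Hs. rewrite <- HRe, <- INR_IZR_INZ, Rpower_pow by lra.
      apply is_RInt_harmonic_taylor. lia. }
  assert (E2 : harmonic P (Cconj kappa) (- Z.of_nat n) r = 0).
  { rewrite (harmonic_power_law P D N c (Cconj kappa) (- Z.of_nat n) 0);
      try assumption; [ring | lia |].
    intros s Hs. rewrite Rmult_0_l. apply is_RInt_harmonic_taylor_off. lia. }
  assert (E0 : harmonic P 1%C 0 r = 2 * PI * Re (c O)).
  { rewrite (harmonic_power_law P D N c 1%C 0 (2 * PI * Re (c O)));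
      try assumption; [| lia |].
    - rewrite Rpower_O by lra. ring.
    - intros s Hs. rewrite Rpower_O by lra.
      assert (H := is_RInt_harmonic_taylor c N 0 1%C s ltac:(lia)).
      rewrite Cmult_1_l in H. exact H. }
  assert (Hr' : 0 <= r < 1) by lra.
  assert (X1 := ex_RInt_harmonic P D kappa (Z.of_nat n) r Hr' HP).
  assert (X2 := ex_RInt_harmonic P D (Cconj kappa) (- Z.of_nat n) r Hr' HP).
  assert (X0 := ex_RInt_harmonic P D 1%C 0 r Hr' HP).
  assert (Hle : harmonic P kappa (Z.of_nat n) r + harmonic P (Cconj kappa) (- Z.of_nat n) r
                <= 2 * harmonic P 1%C 0 r).
  { unfold harmonic.
    assert (S1 := is_RInt_plus (V := R_CompleteNormedModule) _ _ _ _ _ _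
       (RInt_correct (V := R_CompleteNormedModule) _ _ _ X1)
       (RInt_correct (V := R_CompleteNormedModule) _ _ _ X2)).
    assert (S2 := is_RInt_scal (V := R_CompleteNormedModule) _ _ _ 2 _
       (RInt_correct (V := R_CompleteNormedModule) _ _ _ X0)).
    refine (is_RInt_le _ _ _ _ _ _ _ S1 S2 _); [lra|].
    intros t _.
    change (Re (P (circle r t) * wave kappa (Z.of_nat n) t)%C
            + Re (P (circle r t) * wave (Cconj kappa) (- Z.of_nat n) t)%C
            <= 2 * Re (P (circle r t) * wave 1%C 0 t)%C).
    assert (Hw : wave (Cconj kappa) (- Z.of_nat n) t = Cconj (wave kappa (Z.of_nat n) t)).
    { unfold wave. rewrite opp_IZR, Cmult_conj, <- cis_opp. do 2 f_equal. ring. }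
    assert (H1 : wave 1%C 0 t = 1%C).
    { unfold wave. replace (- 0 * t) with 0 by ring.
      unfold cis. rewrite cos_0, sin_0. apply Cmult_1_l. }
    rewrite Hw, H1, Cmult_1_r.
    set (w := wave kappa (Z.of_nat n) t).
    assert (Hw1 : Re w <= 1).
    { eapply Rle_trans; [apply Rle_abs|]. eapply Rle_trans; [apply re_le_Cmod|].
      unfold w. rewrite Cmod_wave, Hk. lra. }
    specialize (Hpos (circle r t) (in_disk_circle r t Hr')).
    set (p := P (circle r t)) in *.
    replace (Re (p * w)%C + Re (p * Cconj w)%C) with (2 * (Re p * Re w))
      by (unfold Re, Cmult, Cconj; simpl; ring).
    assert (Re p * Re w <= Re p * 1) by (apply Rmult_le_compat_l; assumption).
    lra. }
  rewrite E1, E2, E0 in Hle.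
  apply (Rmult_le_reg_l (2 * PI)); lra.
Qed.

(** * Taylor coefficients of the starlike quotient *)

Definition derivative_coef (c : nat -> C) (k : nat) : C := (RtoC (INR (S k)) * c (S k))%C.

Lemma Cpow_first_order (k : nat) :
  exists B, 0 <= B /\ forall z h, Cmod z <= 1 -> Cmod h <= 1 ->
    Cmod ((z + h) ^ S k - z ^ S k - RtoC (INR (S k)) * z ^ k * h) <= B * Cmod h ^ 2.
Proof.
  induction k as [|k [B [HB IH]]].
  - exists 0. split; [lra|]. intros z h _ _. simpl.
    replace (_ - _)%C with (RtoC 0) by ring. rewrite Cmod_0. lra.
  - exists (2 * B + INR (S k)).
    assert (hk := pos_INR (S k)). split; [lra|]. intros z h Hz Hh.
    specialize (IH z h Hz Hh).
    replace (_ - _)%C with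
      ((z + h) * ((z + h) ^ S k - z ^ S k - RtoC (INR (S k)) * z ^ k * h)
       + RtoC (INR (S k)) * z ^ k * h ^ 2)%C.
    2:{ rewrite (S_INR (S k)), RtoC_plus, !(Cpow_S _ (S k)), (Cpow_S z k). ring. }
    eapply Rle_trans; [apply Cmod_triangle|].
    rewrite !Cmod_mult, !Cmod_pow, Cmod_R, (Rabs_pos_eq (INR (S k))) by exact hk.
    assert (hz := Cmod_ge_0 z). assert (hh := Cmod_ge_0 h).
    assert (Hzh : Cmod (z + h) <= 2)
      by (eapply Rle_trans; [apply Cmod_triangle|lra]).
    assert (H1 : Cmod (z + h) * Cmod ((z + h) ^ S k - z ^ S k - RtoC (INR (S k)) * z ^ k * h)
      <= 2 * (B * Cmod h ^ 2)) by (apply Rmult_le_compat; auto using Cmod_ge_0).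
    assert (Hpk : Cmod z ^ k <= 1) by (rewrite <- (pow1 k); apply pow_incr; lra).
    assert (H2 : INR (S k) * Cmod z ^ k * Cmod h ^ 2 <= INR (S k) * 1 * Cmod h ^ 2).
    { apply Rmult_le_compat_r; [apply pow2_ge_0|]. apply Rmult_le_compat_l; assumption. }
    lra.
Qed.

Lemma taylor_poly_first_order (c : nat -> C) (N : nat) :
  exists B, 0 <= B /\ forall z h, Cmod z <= 1 -> Cmod h <= 1 ->
    Cmod (taylor_poly c (S N) (z + h) - taylor_poly c (S N) z
          - taylor_poly (derivative_coef c) N z * h) <= B * Cmod h ^ 2.
Proof.
  induction N as [|N [B [HB IH]]].
  - exists 0. split; [lra|]. intros z h _ _.
    unfold derivative_coef. simpl.
    replace (_ - _)%C with (RtoC 0) by ring. rewrite Cmod_0. lra.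
  - destruct (Cpow_first_order (S N)) as [B' [HB' H']].
    assert (hc := Cmod_ge_0 (c (S (S N)))).
    exists (B + Cmod (c (S (S N))) * B').
    split; [assert (0 <= Cmod (c (S (S N))) * B') by (apply Rmult_le_pos; assumption); lra|].
    intros z h Hz Hh. specialize (IH z h Hz Hh). specialize (H' z h Hz Hh).
    replace (_ - _)%C with
      (taylor_poly c (S N) (z + h) - taylor_poly c (S N) z
          - taylor_poly (derivative_coef c) N z * h
       + c (S (S N)) * ((z + h) ^ S (S N) - z ^ S (S N)
                        - RtoC (INR (S (S N))) * z ^ S N * h))%C.
    2:{ change (taylor_poly c (S (S N)) (z + h))
          with (taylor_poly c (S N) (z + h) + c (S (S N)) * (z + h) ^ S (S N))%C.
        change (taylor_poly c (S (S N)) z)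
          with (taylor_poly c (S N) z + c (S (S N)) * z ^ S (S N))%C.
        change (taylor_poly (derivative_coef c) (S N) z)
          with (taylor_poly (derivative_coef c) N z
                + RtoC (INR (S (S N))) * c (S (S N)) * z ^ S N)%C.
        ring. }
    eapply Rle_trans; [apply Cmod_triangle|]. rewrite Cmod_mult.
    assert (Cmod (c (S (S N))) * Cmod ((z + h) ^ S (S N) - z ^ S (S N)
                        - RtoC (INR (S (S N))) * z ^ S N * h)
            <= Cmod (c (S (S N))) * (B' * Cmod h ^ 2))
      by (apply Rmult_le_compat_l; assumption).
    lra.
Qed.

Lemma pow_sum_le (x y : R) (n : nat) :
  0 <= x -> 0 <= y -> (x + y) ^ n <= 2 ^ n * (x ^ n + y ^ n).
Proof.
  intros Hx Hy.
  assert (hx := pow_le x n Hx). assert (hy := pow_le y n Hy).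
  assert (h2 : 0 < 2 ^ n) by (apply pow_lt; lra).
  destruct (Rle_lt_dec x y) as [H|H].
  - apply Rle_trans with ((2 * y) ^ n); [apply pow_incr; lra|].
    rewrite Rpow_mult_distr. apply Rmult_le_compat_l; lra.
  - apply Rle_trans with ((2 * x) ^ n); [apply pow_incr; lra|].
    rewrite Rpow_mult_distr. apply Rmult_le_compat_l; lra.
Qed.

(** The increments of [f - T], for [T] the Taylor polynomial of degree [N + 1], are
    bounded by [K (|z| + |h|)^(N+1) |h|], so that its derivative at [z] is of order
    [N + 1].  The series is thus differentiated without interchanging limits. *)
Lemma bigO_taylor_derivative (f : C -> C) (c : nat -> C) (r : R) (N : nat) :
  0 < r -> (forall u, Cmod u < r -> is_pseries c u (f u)) -> analytic_on_disk f ->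
  bigO (S N) (fun z => C_derive f z - taylor_poly (derivative_coef c) N z)%C.
Proof.
  intros Hr Hf Han.
  destruct (taylor_remainder_lipschitz c r f (S N) Hr Hf) as [K [d [HK [Hd H]]]].
  destruct (taylor_poly_first_order c N) as [B [HB HT]].
  assert (H2 : 0 < 2 ^ S N) by (apply pow_lt; lra).
  exists (K * 2 ^ S N), (Rmin 1 (d / 2)).
  split; [apply Rmult_lt_0_compat; assumption|].
  split; [apply Rmin_pos; lra|]. intros z Hz.
  assert (Hz1 := Rlt_le_trans _ _ _ Hz (Rmin_l _ _)).
  assert (Hz2 := Rlt_le_trans _ _ _ Hz (Rmin_r _ _)).
  destruct (analytic_strict_diff f z Han Hz1) as [l Hl].
  rewrite (strict_diff_C_derive f z l Hl).
  destruct (strict_diff_quadratic f z l Hl) as [K' [d' [HK' [Hd' Hq]]]].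
  apply (Cmod_slope_le _ _ (K * 2 ^ S N + K' + B) (Rmin d' (Rmin 1 (d / 2)))).
  { repeat apply Rmin_pos; lra. }
  intros h Hh.
  assert (Hh1 := Rlt_le_trans _ _ _ Hh (Rmin_l _ _)).
  assert (Hh' := Rlt_le_trans _ _ _ Hh (Rmin_r _ _)).
  assert (Hh2 := Rlt_le_trans _ _ _ Hh' (Rmin_l _ _)).
  assert (Hh3 := Rlt_le_trans _ _ _ Hh' (Rmin_r _ _)).
  specialize (Hq h Hh1). specialize (HT z h ltac:(lra) ltac:(lra)).
  assert (hz := Cmod_ge_0 z). assert (hh := Cmod_ge_0 h).
  specialize (H (Cmod z + Cmod h) z (z + h)%C ltac:(lra) ltac:(lra) (Cmod_triangle z h)).
  replace (z + h - z)%C with h in H by ring.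
  replace ((l - taylor_poly (derivative_coef c) N z) * h)%C with
    (f (z + h) - f z - (taylor_poly c (S N) (z + h) - taylor_poly c (S N) z)
     + - (f (z + h) - f z - l * h)
     + (taylor_poly c (S N) (z + h) - taylor_poly c (S N) z
          - taylor_poly (derivative_coef c) N z * h))%C by ring.
  eapply Rle_trans; [apply Cmod_triangle|].
  eapply Rle_trans; [apply Rplus_le_compat_r, Cmod_triangle|]. rewrite Cmod_opp.
  assert (Hp := pow_sum_le (Cmod z) (Cmod h) (S N) hz hh).
  assert (HhN : Cmod h ^ S N <= Cmod h).
  { simpl. rewrite <- (Rmult_1_r (Cmod h)) at 3. apply Rmult_le_compat_l; [exact hh|].
    rewrite <- (pow1 N). apply pow_incr. lra. }
  assert (HB1 : K * (Cmod z + Cmod h) ^ S N * Cmod h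
                <= K * (2 ^ S N * (Cmod z ^ S N + Cmod h)) * Cmod h).
  { apply Rmult_le_compat_r; [exact hh|]. apply Rmult_le_compat_l; [lra|].
    eapply Rle_trans; [exact Hp|]. apply Rmult_le_compat_l; lra. }
  lra.
Qed.

(** The coefficients of [z f'/f] for [f = z + a_2 z^2 + ...], up to order 4. *)
Definition starlike_coef (a : nat -> C) (k : nat) : C :=
  match k with
  | 0%nat => 1
  | 1%nat => a 2%nat
  | 2%nat => 2 * a 3%nat - a 2%nat ^ 2
  | 3%nat => 3 * a 4%nat - 3 * a 2%nat * a 3%nat + a 2%nat ^ 3
  | _ => 4 * a 5%nat - 4 * a 2%nat * a 4%nat - 2 * a 3%nat ^ 2
         + 4 * a 2%nat ^ 2 * a 3%nat - a 2%nat ^ 4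
  end%C.

(** If [Q] is the candidate Taylor polynomial, then [z f' - Q f] has order 6, since
    the coefficients of [Q] solve the corresponding linear system; dividing by
    [f], of exact order 1, leaves order 5. *)
Lemma bigO_starlike_quotient (f : C -> C) (a : nat -> C) (r : R) :
  0 < r -> (forall u, Cmod u < r -> is_pseries a u (f u)) -> analytic_on_disk f ->
  a 0%nat = 0%C -> a 1%nat = 1%C ->
  bigO 5 (fun z => starlike_quotient f z - taylor_poly (starlike_coef a) 4 z)%C.
Proof.
  intros Hr Hf Han Ha0 Ha1.
  assert (R5 := bigO_taylor_remainder f a r 5 Hr Hf).
  assert (R1 := bigO_taylor_remainder f a r 1 Hr Hf).
  assert (D4 := bigO_taylor_derivative f a r 4 Hr Hf Han).
  pose (Q := taylor_poly (starlike_coef a) 4).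
  pose (s := starlike_coef a).
  (* The coefficients of [z^6] to [z^9] in the product of [Q] and the Taylor
     polynomial of [f]. *)
  pose (e k := match k with
    | 0%nat => s 1%nat * a 5%nat + s 2%nat * a 4%nat + s 3%nat * a 3%nat + s 4%nat * a 2%nat
    | 1%nat => s 2%nat * a 5%nat + s 3%nat * a 4%nat + s 4%nat * a 3%nat
    | 2%nat => s 3%nat * a 5%nat + s 4%nat * a 4%nat
    | _ => s 4%nat * a 5%nat end%C).
  assert (Hnum : bigO 6 (fun z => z * C_derive f z - Q z * f z)%C).
  { apply (bigO_ext 6 (fun z =>
      z * (C_derive f z - taylor_poly (derivative_coef a) 4 z)
      + ((-1) * (Q z * (f z - taylor_poly a 5 z)) + (-1) * (z ^ 6 * taylor_poly e 3 z)))%C).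
    - intros z. unfold Q, e, s, derivative_coef, starlike_coef.
      cbn [taylor_poly]. rewrite !INR_IZR_INZ, Ha0, Ha1.
      cbn [Z.of_nat Pos.of_succ_nat Pos.succ]. ring.
    - apply bigO_plus; [|apply bigO_plus; apply bigO_scal].
      + exact (bigO_mult 1 5 _ _ bigO_id D4).
      + exact (bigO_mult 0 6 _ _ (bigO_taylor_poly _ 4) R5).
      + exact (bigO_mult 6 0 _ _ (bigO_pow 6) (bigO_taylor_poly _ 3)). }
  destruct Hnum as [K [d [HK [Hd H]]]].
  destruct R1 as [K1 [d1 [HK1 [Hd1 H1]]]].
  pose (d2 := / (2 * K1)).
  assert (Hd2 : 0 < d2) by (apply Rinv_0_lt_compat; lra).
  exists (2 * K), (Rmin d (Rmin d1 d2)).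
  split; [lra|split; [repeat apply Rmin_pos; lra|]]. intros z Hz.
  assert (Hza := Rlt_le_trans _ _ _ Hz (Rmin_l _ _)).
  assert (Hz' := Rlt_le_trans _ _ _ Hz (Rmin_r _ _)).
  assert (Hzb := Rlt_le_trans _ _ _ Hz' (Rmin_l _ _)).
  assert (Hzc := Rlt_le_trans _ _ _ Hz' (Rmin_r _ _)).
  specialize (H z Hza). specialize (H1 z Hzb).
  unfold starlike_quotient. destruct (Ceq_dec z 0%C) as [->|Hz0].
  - unfold starlike_coef. simpl.
    replace (_ - _)%C with (RtoC 0) by ring.
    rewrite Cmod_0, Rmult_0_l, Rmult_0_r. apply Rle_refl.
  - assert (Hzp : 0 < Cmod z) by (apply Cmod_gt_0, Hz0).
    cbn [taylor_poly] in H1. rewrite Ha0, Ha1 in H1.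
    assert (Hfl : Cmod z / 2 <= Cmod (f z)).
    { assert (Hs : K1 * Cmod z ^ 2 <= Cmod z / 2).
      { unfold d2 in Hzc. assert (K1 * Cmod z <= / 2).
        { apply Rlt_le. apply (Rmult_lt_compat_l K1) in Hzc; [|exact HK1].
          replace (K1 * / (2 * K1)) with (/ 2) in Hzc by (field; lra). exact Hzc. }
        simpl. rewrite Rmult_1_r, <- Rmult_assoc.
        apply (Rmult_le_compat_r (Cmod z)) in H0; lra. }
      assert (Ht : Cmod z <= Cmod (f z) + Cmod (f z - (0 + 1 * z ^ 1))).
      { replace z with (f z + - (f z - (0 + 1 * z ^ 1)))%C at 1 by (simpl; ring).
        eapply Rle_trans; [apply Cmod_triangle|]. rewrite Cmod_opp. lra. }
      lra. }
    assert (Hfn : f z <> 0%C) by (intros E; rewrite E, Cmod_0 in Hfl; lra).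
    replace (z * C_derive f z / f z - taylor_poly (starlike_coef a) 4 z)%C
      with ((z * C_derive f z - Q z * f z) / f z)%C by (unfold Q; field; exact Hfn).
    rewrite Cmod_div by exact Hfn.
    apply Rle_div_l; [lra|].
    eapply Rle_trans; [exact H|].
    assert (Hp : 0 < Cmod z ^ 5) by (apply pow_lt, Hzp).
    replace (K * Cmod z ^ 6) with (2 * K * Cmod z ^ 5 * (Cmod z / 2)) by (simpl; field).
    apply Rmult_le_compat_l; [|exact Hfl].
    apply Rlt_le. repeat apply Rmult_lt_0_compat; lra.
Qed.

(** The expansion of [g] is substituted into that of [f] in [f (g w) = w], and the
    coefficients of [w], [w^2] and [w^3] are compared. *)
Lemma inverse_coefficients (f g : C -> C) (a b : nat -> C) (ra rb : R) :
  0 < ra -> (forall u, Cmod u < ra -> is_pseries a u (f u)) ->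
  0 < rb -> (forall u, Cmod u < rb -> is_pseries b u (g u)) ->
  a 0%nat = 0%C -> a 1%nat = 1%C ->
  b 0%nat = 0%C ->
  (exists r, 0 < r /\ forall w, Cmod w < r -> f (g w) = w) ->
  b 1%nat = 1%C /\ b 2%nat = (- a 2%nat)%C /\
  b 3%nat = (2 * a 2%nat ^ 2 - a 3%nat)%C.
Proof.
  intros Hra Hf Hrb Hg Ha0 Ha1 Hb0 [r [Hr Hfg]].
  assert (F3 := bigO_taylor_remainder f a ra 3 Hra Hf).
  assert (G3 := bigO_taylor_remainder g b rb 3 Hrb Hg).
  assert (G2 := bigO_taylor_remainder g b rb 2 Hrb Hg).
  assert (G1 := bigO_taylor_remainder g b rb 1 Hrb Hg).
  assert (G0 := bigO_taylor_remainder g b rb 0 Hrb Hg).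
  apply (bigO_ext 1 _ g) in G0; [|intros z; simpl; rewrite Hb0; ring].
  assert (FG := bigO_comp 4 _ g F3 G0). cbv beta in FG.
  pose (c k := match k with
     | 0%nat => RtoC 0
     | 1%nat => b 1%nat - 1
     | 2%nat => b 2%nat + a 2%nat * b 1%nat ^ 2
     | _ => b 3%nat + 2 * a 2%nat * b 1%nat * b 2%nat + a 3%nat * b 1%nat ^ 3
     end%C).
  assert (L1 : bigO 1 (fun z => b 1%nat * z)%C) by apply bigO_scal, bigO_id.
  assert (L2 : bigO 1 (fun z => b 1%nat * z + b 2%nat * z ^ 2)%C).
  { apply bigO_plus; [exact L1|]. apply bigO_scal, (bigO_weaken 1 2); [lia|apply bigO_pow]. }
  (* Each power of [g w] is replaced by just enough of its expansion for the
     error to have order 4. *)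
  assert (Hc : bigO 4 (taylor_poly c 3)).
  { assert (Hbig : bigO 4 (fun w =>
      (-1) * (f (g w) - taylor_poly a 3 (g w))
      + ((-1) * (g w - taylor_poly b 3 w)
      + (- a 2%nat * ((g w - taylor_poly b 2 w)
                      * (g w + (b 1%nat * w + b 2%nat * w ^ 2)))
      + (- a 2%nat * b 2%nat ^ 2 * w ^ 4
      + - a 3%nat * ((g w - taylor_poly b 1 w)
          * (g w * g w + (g w * (b 1%nat * w) + b 1%nat * w * (b 1%nat * w))))))))%C).
    { repeat apply bigO_plus; try apply bigO_scal.
      - exact FG.
      - exact G3.
      - exact (bigO_mult 3 1 _ _ G2 (bigO_plus 1 _ _ G0 L2)).
      - apply bigO_pow.
      - apply (bigO_mult 2 2 _ _ G1).
        repeat apply bigO_plus; apply (bigO_mult 1 1); assumption. }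
    destruct Hbig as [K [d [HK [Hd H]]]].
    exists K, (Rmin d r). split; [exact HK|split; [apply Rmin_pos; assumption|]].
    intros w Hw. specialize (H w (Rlt_le_trans _ _ _ Hw (Rmin_l _ _))).
    rewrite Hfg in H by exact (Rlt_le_trans _ _ _ Hw (Rmin_r _ _)).
    eapply Rle_trans; [|exact H]. apply Req_le. f_equal.
    unfold c. cbn [taylor_poly]. rewrite Ha0, Ha1, Hb0. ring. }
  assert (H := bigO_taylor_poly_zero c 3 Hc).
  assert (E1 := H 1%nat ltac:(lia)). assert (E2 := H 2%nat ltac:(lia)).
  assert (E3 := H 3%nat ltac:(lia)). unfold c in E1, E2, E3.
  assert (B1 : b 1%nat = 1%C).
  { replace (b 1%nat) with (b 1%nat - 1 + 1)%C by ring. rewrite E1. ring. }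
  rewrite B1 in E2, E3.
  assert (B2 : b 2%nat = (- a 2%nat)%C).
  { replace (b 2%nat) with (b 2%nat + a 2%nat * 1 ^ 2 - a 2%nat)%C by ring.
    rewrite E2. ring. }
  rewrite B2 in E3. split; [exact B1|split; [exact B2|]].
  replace (b 3%nat) with
    (b 3%nat + 2 * a 2%nat * 1 * - a 2%nat + a 3%nat * 1 ^ 3
     + (2 * a 2%nat ^ 2 - a 3%nat))%C by ring.
  rewrite E3. ring.
Qed.

(** * The fifth coefficient *)

(** Inversion maps the disk [|1 - u| < 1] into the half-plane [Re > 1/2]. *)
Lemma Re_inv_one_minus_ge (w : C) : in_disk w -> 1 / 2 <= Re (/ (1 - w))%C.
Proof.
  intros Hw.
  assert (H2 : Re w ^ 2 + Im w ^ 2 < 1).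
  { rewrite <- Cmod2_alt. unfold in_disk in Hw. assert (h := Cmod_ge_0 w). nra. }
  destruct w as [x y]. unfold Re, Im in *. simpl in *.
  assert (Hx : x < 1) by nra.
  assert (Hq : 0 < (1 - x) * (1 - x) + y * y) by nra.
  replace ((1 + - x) / ((1 + - x) * ((1 + - x) * 1) + (0 + - y) * ((0 + - y) * 1)))
    with ((1 - x) / ((1 - x) * (1 - x) + y * y)) by (f_equal; ring).
  apply (proj1 (Rle_div_r (1 / 2) _ _ Hq)). lra.
Qed.

(** Since the half-plane map is [rho - b + 2 b / (1 - w)] with [b = 1 - rho], the
    starlike quotient minus [rho] has nonnegative real part and value [b] at 0.
    Its smoothness on the disk comes from the subordinating function [w], its
    Taylor coefficients at 0 come from [f]. *)
Lemma starlike_coef_bound (rho r : R) (f : C -> C) (a : nat -> C) (n : nat) :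
  rho < 1 -> analytic_on_disk f -> 0 < r ->
  (forall u, Cmod u < r -> is_pseries a u (f u)) ->
  a 0%nat = 0%C -> a 1%nat = 1%C ->
  subordinate (starlike_quotient f) (half_plane_map rho) ->
  (1 <= n <= 4)%nat -> Cmod (starlike_coef a n) <= 2 * (1 - rho).
Proof.
  intros Hrho Han Hr Hf Ha0 Ha1 [w [Hw [Hw0 Hsub]]] Hn.
  pose (beta := 1 - rho).
  pose (P z := (- RtoC beta + 2 * RtoC beta * / (1 - w z))%C).
  assert (Hne : forall z, in_disk z -> (1 - w z)%C <> 0%C).
  { intros z Hz E. destruct (Hsub z Hz) as [Hwz _]. unfold in_disk in Hwz.
    replace (w z) with (1 - (1 - w z))%C in Hwz by ring.
    rewrite E in Hwz. replace (1 - 0)%C with (RtoC 1) in Hwz by ring.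
    rewrite Cmod_1 in Hwz. lra. }
  assert (HP : forall z, in_disk z -> strict_diff P z (C_derive P z)).
  { intros z Hz.
    assert (exists l, strict_diff P z l) as [l Hl].
    { destruct (analytic_strict_diff w z Hw Hz) as [l Hl].
      eexists. apply strict_diff_affine, strict_diff_inv; [|exact (Hne z Hz)].
      assert (H := strict_diff_affine w 1%C (- (1))%C z l Hl).
      destruct H as [K [d [HK [Hd H]]]]. exists K, d.
      split; [exact HK|split; [exact Hd|]]. intros y z' Hy Hz'.
      specialize (H y z' Hy Hz').
      replace (1 - w z' - (1 - w y))%C with (1 + - (1) * w z' - (1 + - (1) * w y))%C
        by ring.
      exact H. }
    rewrite (strict_diff_C_derive P z l Hl). exact Hl. }
  assert (Hpos : forall z, in_disk z -> 0 <= Re (P z)).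
  { intros z Hz. destruct (Hsub z Hz) as [Hwz _].
    assert (H := Re_inv_one_minus_ge _ Hwz). unfold P.
    replace (Re _) with (beta * (2 * Re (/ (1 - w z))%C - 1))
      by (unfold Re, RtoC; simpl; ring).
    apply Rmult_le_pos; unfold beta; lra. }
  pose (c k := match k with O => RtoC beta | _ => starlike_coef a k end).
  assert (HT : bigO 5 (fun z => P z - taylor_poly c 4 z)%C).
  { destruct (bigO_starlike_quotient f a r Hr Hf Han Ha0 Ha1) as [K [d [HK [Hd H]]]].
    exists K, (Rmin d 1). split; [exact HK|split; [apply Rmin_pos; lra|]]. intros z Hz.
    specialize (H z (Rlt_le_trans _ _ _ Hz (Rmin_l _ _))).
    assert (Hz1 : in_disk z) by exact (Rlt_le_trans _ _ _ Hz (Rmin_r _ _)).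
    rewrite (proj2 (Hsub z Hz1)) in H.
    eapply Rle_trans; [|exact H]. apply Req_le. f_equal.
    unfold P, c, half_plane_map, beta. cbn [taylor_poly starlike_coef].
    rewrite !RtoC_minus, RtoC_mult. field. exact (Hne z Hz1). }
  assert (H := caratheodory_coefficient_bound P _ 4 n c HP Hpos HT Hn).
  destruct n as [|n]; [lia|]. exact H.
Qed.

(** The terms add up to [b/2 + 5/3 b^2 + 2/3 b sqrt (2 b)]; as [b <= 1], a sixth of
    [b^2] may be replaced by a sixth of [b]. *)
Lemma a5_bound (b : R) (s1 s2 s3 s4 : C) :
  0 <= b <= 1 ->
  Cmod s1 ^ 2 <= 2 * b -> Cmod s2 <= 2 * b -> Cmod s3 <= 2 * b -> Cmod s4 <= 2 * b ->
  Cmod (s4 / 4 + s1 * s3 / 3 + s2 ^ 2 / 8 + s1 ^ 2 * s2 / 4 + s1 ^ 4 / 24)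
    <= 2 / 3 * b + 3 / 2 * b ^ 2 + 2 / 3 * b * sqrt (2 * b).
Proof.
  intros Hb H1 H2 H3 H4.
  assert (Hx : Cmod s1 <= sqrt (2 * b)).
  { rewrite <- (sqrt_pow2 (Cmod s1)) by apply Cmod_ge_0. apply sqrt_le_1_alt, H1. }
  assert (hx := Cmod_ge_0 s1). assert (h2 := Cmod_ge_0 s2).
  assert (h3 := Cmod_ge_0 s3). assert (hq := sqrt_pos (2 * b)).
  assert (Hdiv : forall (x : C) (k : R), 0 < k -> Cmod (x / RtoC k) = Cmod x / k).
  { intros x k Hk. rewrite Cmod_div, Cmod_R, Rabs_pos_eq; [reflexivity|lra|].
    intros E. apply RtoC_inj in E. lra. }
  eapply Rle_trans; [apply Cmod_triangle|].
  eapply Rle_trans; [apply Rplus_le_compat_r, Cmod_triangle|].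
  eapply Rle_trans; [do 2 apply Rplus_le_compat_r; apply Cmod_triangle|].
  eapply Rle_trans; [do 3 apply Rplus_le_compat_r; apply Cmod_triangle|].
  rewrite !Hdiv by lra. rewrite !Cmod_mult, !Cmod_pow.
  assert (E1 : Cmod s1 * Cmod s3 <= sqrt (2 * b) * (2 * b))
    by (apply Rmult_le_compat; assumption).
  assert (E2 : Cmod s2 ^ 2 <= (2 * b) ^ 2) by (apply pow_incr; lra).
  assert (E3 : Cmod s1 ^ 2 * Cmod s2 <= 2 * b * (2 * b))
    by (apply Rmult_le_compat; try assumption; apply pow2_ge_0).
  assert (E4 : Cmod s1 ^ 4 <= (2 * b) ^ 2).
  { replace (Cmod s1 ^ 4) with ((Cmod s1 ^ 2) ^ 2) by ring.
    apply pow_incr; split; [apply pow2_ge_0|exact H1]. }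
  assert (Hbb : b * b <= b) by nra.
  lra.
Qed.

Theorem theorem3p1 :
  forall (rho : R) (f : C -> C) (a : nat -> C),
    0 <= rho <= 1 / 2 ->
    ST_sigma rho f ->
    a 0%nat = 0%C -> a 1%nat = 1%C ->
    (forall z : C, in_disk z -> is_pseries a z (f z)) ->
    Cmod (a 5%nat) <=
      2 / 3 * (1 - rho) + 3 / 2 * (1 - rho) ^ 2
      + 2 / 3 * sqrt 2 * Rpower (1 - rho) (3 / 2).
Proof.
  intros rho f a Hrho [[[Hfan [Hf0 _]] [[_ Hfinj] _]] [g [Hg [Hsubf Hsubg]]]] Ha0 Ha1 Hf.
  destruct Hg as [[Hgan _] [r0 [Hr0 Hfg]]].
  assert (H0 : in_disk 0%C) by (unfold in_disk; rewrite Cmod_0; lra).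
  assert (Hg0 : g 0%C = 0%C).
  { destruct (Hfg 0%C) as [Hin Heq]; [rewrite Cmod_0; exact Hr0|].
    apply Hfinj; try assumption. congruence. }
  destruct (Hgan 0%C H0) as [b [rb [Hrb Hb]]].
  assert (Hgb : forall u, Cmod u < rb -> is_pseries b u (g u)).
  { intros u Hu. specialize (Hb u). replace (u - 0)%C with u in Hb by ring. auto. }
  assert (Hb0 : b 0%nat = 0%C).
  { rewrite <- Hg0. symmetry. apply is_pseries_at_0, Hgb. rewrite Cmod_0. exact Hrb. }
  destruct (inverse_coefficients f g a b 1 rb Rlt_0_1 Hf Hrb Hgb Ha0 Ha1 Hb0)
    as [Hb1 [Hb2 Hb3]].
  { exists r0. split; [exact Hr0|]. intros w Hw. apply Hfg, Hw. }
  assert (HS : forall n, (1 <= n <= 4)%nat -> Cmod (starlike_coef a n) <= 2 * (1 - rho)).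
  { intros n. apply (starlike_coef_bound rho 1 f); try assumption; lra. }
  assert (T2 : Cmod (starlike_coef b 2) <= 2 * (1 - rho)).
  { apply (starlike_coef_bound rho rb g); try assumption; try lra. lia. }
  assert (S2 := HS 2%nat ltac:(lia)). assert (S3 := HS 3%nat ltac:(lia)).
  assert (S4 := HS 4%nat ltac:(lia)).
  (* The only use of the inverse function: [s_2 + t_2 = 2 s_1^2]. *)
  assert (S1 : Cmod (starlike_coef a 1) ^ 2 <= 2 * (1 - rho)).
  { assert (E : (2 * a 2%nat ^ 2 = starlike_coef a 2 + starlike_coef b 2)%C).
    { unfold starlike_coef. rewrite Hb2, Hb3. ring. }
    assert (H : Cmod (2 * a 2%nat ^ 2) <= 2 * (1 - rho) + 2 * (1 - rho)).
    { rewrite E. eapply Rle_trans; [apply Cmod_triangle|]. lra. }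
    rewrite Cmod_mult, Cmod_pow, Cmod_R, Rabs_pos_eq in H by lra.
    unfold starlike_coef. lra. }
  assert (Hfin := a5_bound (1 - rho) _ _ _ _ ltac:(lra) S1 S2 S3 S4).
  replace (2 / 3 * sqrt 2 * Rpower (1 - rho) (3 / 2))
    with (2 / 3 * (1 - rho) * sqrt (2 * (1 - rho))).
  - eapply Rle_trans; [|exact Hfin]. apply Req_le. f_equal.
    unfold starlike_coef. field.
  - rewrite sqrt_mult by lra.
    replace (3 / 2) with (1 + / 2) by lra.
    rewrite Rpower_plus, Rpower_1, Rpower_sqrt by lra. ring.
Qed.
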